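(* Let $X$ be a set with $|X|=\aleph_0$ and let $\alpha,\beta\in\mathcal P_X$. Then $\mathcal P_X=\langle\mathcal S_X\cup\{\alpha,\beta\}\rangle$ if and only if, up to interchanging the names of $\alpha$ and $\beta$ if necessary, $\alpha\in\mathcal L_X$, $\beta\in\mathcal R_X$, $d^*(\alpha)=d(\beta)=\aleph_0$, and either (i) $k^*(\alpha,2)+d^*(\alpha,2)=\aleph_0=k(\beta,2)+d(\beta,3)$, or (ii) $k^*(\alpha,2)+d^*(\alpha,3)=\aleph_0=k(\beta,2)+d(\beta,2)$.
   Context: Partition monoid: let $X'=\{x':x\in X\}$ be a disjoint copy of the set $X$; for $A\subseteq X$ write $A'=\{a':a\in A\}$. The elements of $\mathcal P_X$ are all set partitions $\alpha$ of $X\cup X'$ into nonempty blocks. Product: given $\alpha,\beta\in\mathcal P_X$, let $X''=\{x'':x\in X\}$ be a third disjoint copy of $X$; relabel each lower vertex $x'$ of (a graph whose connected components are the blocks of) $\alpha$ as $x''$, relabel each upper vertex $x$ of (a graph representing) $\beta$ as $x''$, and take the union of the two graphs on vertex set $X\cup X''\cup X'$. Then $\alpha\beta\in\mathcal P_X$ is the partition in which $u,v\in X\cup X'$ lie in the same block if and only if they are joined by a (finite) path in this graph. This makes $\mathcal P_X$ a monoid with identity $\{\{x,x'\}:x\in X\}$. $\mathcal S_X$ denotes the group of units of $\mathcal P_X$: the partitions all of whose blocks have the form $\{x,y'\}$ with $x,y\in X$. For $T\subseteq\mathcal P_X$, $\langle T\rangle$ is the subsemigroup generated by $T$. $\mathcal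 L_X$ is the set of $\alpha\in\mathcal P_X$ such that every $x\in X$ lies in a block meeting $X'$ and distinct elements of $X$ lie in distinct blocks. $\mathcal R_X$ is the set of $\alpha\in\mathcal P_X$ such that every $x'\in X'$ lies in a block meeting $X$ and distinct elements of $X'$ lie in distinct blocks. Parameters: write the blocks of $\alpha\in\mathcal P_X$ as transversal blocks $A_i\cup B_i'$ ($i\in I$) with $A_i,B_i\subseteq X$ nonempty, upper nontransversal blocks $C_j\subseteq X$ ($j\in J$), and lower nontransversal blocks $D_k'\subseteq X'$ ($k\in K$). For a cardinal $\mu\le|X|$ put $k(\alpha,\mu)=|\{i\in I:|A_i|\ge\mu\}|$, $k^*(\alpha,\mu)=|\{i\in I:|B_i|\ge\mu\}|$, $d(\alpha,\mu)=|\{j\in J:|C_j|\ge\mu\}|$, $d^*(\alpha,\mu)=|\{k\in K:|D_k|\ge\mu\}|$, and $d(\alpha)=d(\alpha,1)=|J|$, $d^*(\alpha)=d^*(\alpha,1)=|K|$. *)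

(* Defs.v *)
From HB Require Import structures.
From mathcomp Require Import all_boot.
From mathcomp Require Import boolp classical_sets functions cardinality.
From Stdlib Require Import Relations.

Set Implicit Arguments.
Unset Strict Implicit.
Unset Printing Implicit Defensive.

Local Open Scope classical_set_scope.

(* The vertex set X \cup X' is the type X + X: the upper vertex x is [inl x],
   the lower vertex x' is [inr x]. *)
Record setPartition (X : Type) := SetPartition {
  blocks :> set (set (X + X));
  blocks_partition : partition blocks id [set: X + X] }.

HB.instance Definition _ X := gen_eqMixin (setPartition X).
HB.instance Definition _ X := gen_choiceMixin (setPartition X).

Section SetPartitionTheory.
Variable X : Type.
Implicit Types (a b c : setPartition X) (u v w : X + X).

Definition same_block a u v := exists2 A, blocks a A & A u /\ A v.

Lemma setPartition_eq a b : blocks a = blocks b -> a = b.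
Proof.
by case: a b => [P pP] [Q pQ] /= e; case: _ / e in pQ *; congr SetPartition.
Qed.

Lemma block_uniq a A B u : blocks a A -> blocks a B -> A u -> B u -> A = B.
Proof.
case: a => P [/= _ tP _] PA PB Au Bu.
by apply: (tP A B) => //; exists u.
Qed.

Lemma block_nonempty a A : blocks a A -> A !=set0.
Proof. by case: a => P [/= _ _ +]; apply. Qed.

Lemma same_block_refl a u : same_block a u u.
Proof.
case: a => P [/= cP tP nP].
have : cover P id u by rewrite cP.
by case=> A PA Au; exists A.
Qed.

Lemma same_block_sym a u v : same_block a u v -> same_block a v u.
Proof. by case=> A PA [Au Av]; exists A. Qed.

Lemma same_block_trans a u v w :
  same_block a u v -> same_block a v w -> same_block a u w.
Proof.
move=> [A PA [Au Av]] [B PB [Bv Bw]]; exists A => //; split=> //.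
by rewrite (block_uniq PA PB Av Bv).
Qed.

Lemma blocksE a A : blocks a A <-> exists u, A = same_block a u.
Proof.
have H u B : blocks a B -> B u -> B = same_block a u.
  move=> PB Bu; apply/seteqP; split=> [v Bv|v]; first by exists B.
  by case=> C PC [Cu Cv]; rewrite (block_uniq PB PC Bu Cu).
split=> [PA|[u ->]]; first by have [u Au] := block_nonempty PA; exists u; exact: H.
by have [B PB [Bu _]] := same_block_refl a u; rewrite -(H u B).
Qed.

Lemma setPartitionP a b :
  (forall u v, same_block a u v <-> same_block b u v) -> a = b.
Proof.
move=> ab; apply: setPartition_eq; apply/seteqP.
have e u : same_block a u = same_block b u by apply/seteqP; split=> v /ab.
by split=> A /blocksE[u ->]; apply/blocksE; exists u.
Qed.

Section OfEquiv.
Variable R : relation (X + X).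
Hypotheses (Rr : reflexive _ R) (Rs : symmetric _ R) (Rt : transitive _ R).

Lemma classes_partition : partition (range (fun u => R u)) id [set: X + X].
Proof.
split.
- by apply/seteqP; split=> // u _; exists (R u) => //; exists u.
- move=> _ _ [u _ <-] [v _ <-] [w [/= uw vw]].
  by apply/seteqP; split=> z h; [apply: Rt vw _; apply: Rt (Rs uw) h
                                |apply: Rt uw _; apply: Rt (Rs vw) h].
- by move=> _ [u _ <-]; exists u; exact: Rr.
Qed.

Definition of_equiv : setPartition X := SetPartition classes_partition.

Lemma same_block_of_equiv u v : same_block of_equiv u v <-> R u v.
Proof.
split=> [[_ [w _ <-] [wu wv]]|uv]; first exact: Rt (Rs wu) wv.
by exists (R u); [exists u|split; [exact: Rr|]].
Qed.
End OfEquiv.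

(* Vertices of the product graph on X \cup X'' \cup X'. *)
Inductive vertex3 := Upper of X | Middle of X | Lower of X.

Definition top_emb u :=
  match u with inl x => Upper x | inr x => Middle x end.
Definition bottom_emb u :=
  match u with inl x => Middle x | inr x => Lower x end.
Definition outer_emb u :=
  match u with inl x => Upper x | inr x => Lower x end.

(* Each factor is represented by the graph joining every two vertices of a
   common block. *)
Inductive product_edge a b : relation vertex3 :=
| TopEdge u v : same_block a u v -> product_edge a b (top_emb u) (top_emb v)
| BottomEdge u v :
    same_block b u v -> product_edge a b (bottom_emb u) (bottom_emb v).

Definition joined a b : relation vertex3 :=
  clos_refl_trans _ (product_edge a b).

Lemma joined_sym a b : symmetric _ (joined a b).
Proof.
move=> p q; elim=> [{}p {}q e|r|r s t _ sr _ ts].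
- by apply: rt_step; case: e => u v /same_block_sym; constructor.
- exact: rt_refl.
- exact: rt_trans ts sr.
Qed.

Definition joined_outer a b u v := joined a b (outer_emb u) (outer_emb v).

Lemma joined_outer_refl a b : reflexive _ (joined_outer a b).
Proof. by move=> u; exact: rt_refl. Qed.
Lemma joined_outer_sym a b : symmetric _ (joined_outer a b).
Proof. by move=> u v; exact: joined_sym. Qed.
Lemma joined_outer_trans a b : transitive _ (joined_outer a b).
Proof. by move=> u v w; exact: rt_trans. Qed.

Definition pmul a b : setPartition X :=
  of_equiv (@joined_outer_refl a b) (@joined_outer_sym a b)
           (@joined_outer_trans a b).

Lemma same_block_mul a b u v : same_block (pmul a b) u v <-> joined_outer a b u v.
Proof. exact: same_block_of_equiv. Qed.

Definition vindex u := match u with inl x | inr x => x end.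

Definition same_index u v := vindex u = vindex v.

Lemma same_index_refl : reflexive _ same_index. Proof. by []. Qed.
Lemma same_index_sym : symmetric _ same_index. Proof. by move=> u v; exact: esym. Qed.
Lemma same_index_trans : transitive _ same_index.
Proof. by move=> u v w; exact: etrans. Qed.

(* The classes of [same_index] are the blocks {x, x'}; see [blocks_one]. *)
Definition pone : setPartition X :=
  of_equiv same_index_refl same_index_sym same_index_trans.

Lemma same_block_one u v : same_block pone u v <-> vindex u = vindex v.
Proof. exact: same_block_of_equiv. Qed.

Lemma blocks_one :
  blocks pone = [set A | exists x, A = [set inl x; inr x]].
Proof.
have e (u : X + X) : same_index u = [set inl (vindex u); inr (vindex u)].
  apply/seteqP; split=> v; rewrite /same_index.
    by case: v => y /= ->; [left|right].
  by case=> ->.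
apply/seteqP; split=> A /=; first by case=> u _ <-; exists (vindex u).
by case=> x ->; exists (inl x) => //; rewrite e.
Qed.

Lemma joined_ind a b (Q : vertex3 -> Prop) p q :
  (forall u v, same_block a u v -> Q (top_emb u) -> Q (top_emb v)) ->
  (forall u v, same_block b u v -> Q (bottom_emb u) -> Q (bottom_emb v)) ->
  joined a b p q -> Q p -> Q q.
Proof.
move=> Ha Hb; elim=> [{}p {}q [u v|u v] uv|//|p' q' r _ h1 _ h2 /h1/h2 //].
  exact: Ha uv.
exact: Hb uv.
Qed.

Lemma joined_top a b u v : same_block a u v -> joined a b (top_emb u) (top_emb v).
Proof. by move=> h; apply: rt_step; constructor. Qed.

Lemma joined_bottom a b u v :
  same_block b u v -> joined a b (bottom_emb u) (bottom_emb v).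
Proof. by move=> h; apply: rt_step; constructor. Qed.

Lemma pmul1g : left_id pone pmul.
Proof.
move=> a; apply: setPartitionP => u v; rewrite same_block_mul; split.
- pose f p := match p with Upper x | Middle x => inl x | Lower x => inr x end.
  have fo w : f (outer_emb w) = w by case: w.
  have fb w : f (bottom_emb w) = w by case: w.
  have ft w : f (top_emb w) = inl (vindex w) by case: w.
  move=> j; suff : same_block a u (f (outer_emb v)) by rewrite fo.
  apply: (@joined_ind pone a (fun p => same_block a u (f p)) _ _ _ _ j).
  + by move=> s t; rewrite same_block_one !ft => ->.
  + by move=> s t; rewrite !fb => st us; exact: same_block_trans us st.
  + by rewrite fo; exact: same_block_refl.
- have ob w : joined pone a (bottom_emb w) (outer_emb w).
    case: w => x /=; last exact: rt_refl.
    by apply: (@joined_top pone a (inr x) (inl x)); apply/same_block_one.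
  move=> /(@joined_bottom pone) j; apply: rt_trans (ob v).
  by apply: rt_trans j; apply: joined_sym; exact: ob.
Qed.

Definition flip u := match u with inl x => inr x | inr x => inl x end.

Lemma flipK : involutive flip. Proof. by case. Qed.

Lemma same_block_flip_refl a : reflexive _ (fun u v => same_block a (flip u) (flip v)).
Proof. by move=> u; exact: same_block_refl. Qed.
Lemma same_block_flip_sym a : symmetric _ (fun u v => same_block a (flip u) (flip v)).
Proof. by move=> u v; exact: same_block_sym. Qed.
Lemma same_block_flip_trans a : transitive _ (fun u v => same_block a (flip u) (flip v)).
Proof. by move=> u v w; exact: same_block_trans. Qed.

Definition pstar a : setPartition X :=
  of_equiv (@same_block_flip_refl a) (@same_block_flip_sym a)
           (@same_block_flip_trans a).

Lemma same_block_star a u v :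
  same_block (pstar a) u v <-> same_block a (flip u) (flip v).
Proof. exact: same_block_of_equiv. Qed.

Lemma pstarK : involutive pstar.
Proof. by move=> a; apply: setPartitionP => u v; rewrite !same_block_star !flipK. Qed.

Lemma pstar1 : pstar pone = pone.
Proof.
apply: setPartitionP => u v; rewrite same_block_star !same_block_one.
by case: u v => ? [].
Qed.

Definition flip3 p :=
  match p with Upper x => Lower x | Middle x => Middle x | Lower x => Upper x end.

Lemma joined_star a b p q :
  joined a b p q -> joined (pstar b) (pstar a) (flip3 p) (flip3 q).
Proof.
have ft w : flip3 (top_emb w) = bottom_emb (flip w) by case: w.
have fb w : flip3 (bottom_emb w) = top_emb (flip w) by case: w.
have H := @joined_ind a b (fun r => joined (pstar b) (pstar a) (flip3 p) (flip3 r)) p q.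
move=> j; apply: H => //; last exact: rt_refl.
- move=> u v uv; rewrite !ft => h; apply: rt_trans h _; apply: joined_bottom.
  by rewrite same_block_star !flipK.
- move=> u v uv; rewrite !fb => h; apply: rt_trans h _; apply: joined_top.
  by rewrite same_block_star !flipK.
Qed.

Lemma pstarM a b : pstar (pmul a b) = pmul (pstar b) (pstar a).
Proof.
have fo w : flip3 (outer_emb w) = outer_emb (flip w) by case: w.
apply: setPartitionP => u v; rewrite same_block_star !same_block_mul.
rewrite /joined_outer; split=> /joined_star; rewrite !fo ?flipK ?pstarK //.
Qed.

Lemma pmulg1 : right_id pone pmul.
Proof. by move=> a; rewrite -[LHS]pstarK pstarM pstar1 pmul1g pstarK. Qed.

(* Half of associativity: a walk in the graph of a(bc) is followed in the
   four-row graph and projected onto the graph of (ab)c. *)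
Lemma pmulA_sub a b c u v :
  joined_outer a (pmul b c) u v -> joined_outer (pmul a b) c u v.
Proof.
(* The middle row of the graph of a(bc) is the middle row of the graph of ab;
   [near] says that such a vertex is reached from u. *)
pose near (w : vertex3) := exists2 z,
  joined a b w (outer_emb z) & joined (pmul a b) c (outer_emb u) (top_emb z).
pose Q p := match p with
  | Upper x => joined (pmul a b) c (outer_emb u) (Upper x)
  | Middle x => near (Middle x)
  | Lower x => joined (pmul a b) c (outer_emb u) (Lower x) end.
have near_step (w w' : vertex3) : joined a b w w' -> near w -> near w'.
  move=> j [z wz uz]; exists z => //; apply: rt_trans wz; exact: joined_sym.
have near_outer z : near (outer_emb z) <-> joined (pmul a b) c (outer_emb u) (top_emb z).
  split=> [[y zy uy]|h]; last by exists z => //; exact: rt_refl.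
  by apply: rt_trans uy _; apply: joined_top; apply/same_block_mul/joined_sym.
have QT w : Q (top_emb w) <-> near (top_emb w).
  by case: w => x //=; rewrite (near_outer (inl x)).
pose S p := match p with
  | Upper x => near (Middle x)
  | Middle x => near (Lower x)
  | Lower x => joined (pmul a b) c (outer_emb u) (Lower x) end.
have QB w : Q (bottom_emb w) <-> S (outer_emb w) by case: w.
have ST w : S (top_emb w) <-> near (bottom_emb w) by case: w.
have SB w : S (bottom_emb w) <-> joined (pmul a b) c (outer_emb u) (bottom_emb w).
  by case: w => x //=; rewrite (near_outer (inr x)).
have QO w : Q (outer_emb w) = joined (pmul a b) c (outer_emb u) (outer_emb w).
  by case: w.
move=> j; rewrite /joined_outer -QO.
apply: (@joined_ind a (pmul b c) Q _ _ _ _ j); last by rewrite QO; exact: rt_refl.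
- by move=> s t st; rewrite !QT; apply: near_step; exact: joined_top.
- move=> s t /same_block_mul st; rewrite !QB.
  apply: (@joined_ind b c S _ _ _ _ st) => {st}{}s {}t st.
  + by rewrite !ST; apply: near_step; exact: joined_bottom.
  + by rewrite !SB => h; apply: rt_trans h _; exact: joined_bottom.
Qed.

Lemma pmulA : associative pmul.
Proof.
move=> a b c; apply: setPartitionP => u v; rewrite !same_block_mul.
split; first exact: pmulA_sub.
move=> /same_block_mul; rewrite -[pmul (pmul a b) c]pstarK same_block_star.
rewrite !pstarM => /same_block_mul/pmulA_sub/same_block_mul.
by rewrite -!pstarM same_block_star !flipK => /same_block_mul.
Qed.

End SetPartitionTheory.

HB.instance Definition _ X :=
  isMonoid.Build (setPartition X) (@pmulA X) (@pmul1g X) (@pmulg1 X).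

Local Open Scope group_scope.

Definition subsemigroup (M : semigroupType) (S : set M) :=
  forall x y, S x -> S y -> S (x * y).

Definition generated (M : semigroupType) (T : set M) : set M :=
  smallest (@subsemigroup M) T.

(* The underlying set of the group of units of M. *)
Definition units (M : monoidType) : set M :=
  [set a | exists b, a * b = 1 /\ b * a = 1].
Arguments units M _ : clear implicits.

Definition Sym (X : Type) : set (setPartition X) := units (setPartition X).
Arguments Sym X _ : clear implicits.

Lemma SymE (X : Type) (a : setPartition X) :
  Sym X a <-> forall A, blocks a A -> exists x y, A = [set inl x; inr y].
Proof.
split.
- have U (a' b : setPartition X) : a' * b = 1 ->
      (forall x, exists y, same_block a' (inl x) (inr y)) /\
      (forall x z, same_block a' (inl x) (inl z) -> x = z).
    move=> ab1; have J u v : joined_outer a' b u v <-> vindex u = vindex v.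
      by rewrite -same_block_mul -[pmul _ _]/(a' * b) ab1 same_block_one.
    split=> [x|x z /(@joined_top _ a' b) /(J (inl x) (inl z)) //].
    apply: contrapT => nx.
    have /= j : joined a' b (outer_emb (inl x)) (outer_emb (inr x)) by apply/J.
    pose Q p := match p with
      Upper z => same_block a' (inl x) (inl z) | _ => False end.
    suff: Q (Lower x) by [].
    apply: (@joined_ind _ a' b Q _ _ _ _ j); last exact: same_block_refl.
    + move=> [s|s] [t|t] //= st us; first exact: same_block_trans us st.
      by apply: nx; exists t; exact: same_block_trans us st.
    + by move=> [].
  move=> [b [ab ba]]; have [E1 I1] := U a b ab.
  have [|E2 I2] := U (pstar a) (pstar b).
    by rewrite -[_ * _]pstarM -[pmul b a]/(b * a) ba; exact: pstar1.
  have {}I2 x z : same_block a (inr x) (inr z) -> x = z.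
    by move=> h; apply: I2; rewrite same_block_star.
  move=> A /blocksE[u ->].
  have [x [y [ux uy]]] : exists x y, same_block a u (inl x) /\ same_block a u (inr y).
    case: u => z; last have [t] := E2 z; first have [t] := E1 z.
      by exists z, t; split=> //; exact: same_block_refl.
    by rewrite same_block_star; exists t, z; split=> //; exact: same_block_refl.
  exists x, y; apply/seteqP; split=> [[z|z] uz|v [->|->] //]; [left|right].
    by congr inl; apply: I1; exact: same_block_trans (same_block_sym uz) ux.
  by congr inr; apply: I2; exact: same_block_trans (same_block_sym uz) uy.
- have U (a' : setPartition X) :
      (forall A, blocks a' A -> exists x y, A = [set inl x; inr y]) ->
      a' * pstar a' = 1.
    move=> H.
    have E x : exists2 y, same_block a' (inl x) (inr y) &
        same_block a' (inl x) = [set inl x; inr y].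
      have [|s [t e]] := H (same_block a' (inl x)); first by apply/blocksE; exists (inl x).
      have : same_block a' (inl x) (inl x) by exact: same_block_refl.
      rewrite {1}e => -[[xs]|//]; subst s; exists t => //.
      by rewrite e; right.
    have top x y w : same_block a' (inl x) (inr y) -> same_block a' (inl x) w ->
        w = inl x \/ w = inr y.
      move=> xy xw; have [t _ e] := E x; move: xy xw; rewrite e => -[//|[->]].
      by case=> ->; [left|right].
    apply: setPartitionP => u v; rewrite same_block_one same_block_mul; split.
    + move=> j; have [y uy _] := E (vindex u).
      pose Q p := match p with
        Upper x | Lower x => x = vindex u | Middle x => x = y end.
      have T s t : same_block a' s t -> Q (top_emb s) -> Q (top_emb t).
        move=> st Qs; have : same_block a' (inl (vindex u)) t.
          case: s Qs st => s /= -> //; exact: same_block_trans.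
        by move=> /(top _ _ _ uy)[->|->].
      have fb w : Q (bottom_emb w) = Q (top_emb (flip w)) by case: w.
      have QO w : Q (outer_emb w) = (vindex w = vindex u) by case: w.
      apply/esym; rewrite -QO; apply: (@joined_ind _ a' (pstar a') Q _ _ T _ j).
        by move=> s t; rewrite same_block_star !fb; exact: T.
      by rewrite QO.
    + move=> e; have [y xy _] := E (vindex u).
      have O w : vindex w = vindex u -> joined a' (pstar a') (outer_emb w) (Middle y).
        case: w => x /= ->; first exact: joined_top xy.
        apply: (@joined_bottom _ a' (pstar a') (inr _) (inl _)).
        by rewrite same_block_star.
      by apply: rt_trans (O u _) _ => //; apply: joined_sym; exact: O.
  move=> H; exists (pstar a); split; first exact: U.
  rewrite -{2}[a]pstarK; apply: U => A /blocksE[u ->].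
  have [|x [y e]] := H (same_block a (flip u)); first by apply/blocksE; exists (flip u).
  exists y, x; apply/seteqP; split=> v; rewrite same_block_star.
    rewrite e => -[/(congr1 (@flip X))|/(congr1 (@flip X))]; rewrite flipK => ->.
      by right.
    by left.
  by rewrite e; case=> ->; [right|left].
Qed.

Section BlockCounts.
Variable X : Type.
Implicit Types (a : setPartition X) (A : set (X + X)).

Definition upper A : set X := inl @^-1` A.
Definition lower A : set X := inr @^-1` A.

Definition monoidL : set (setPartition X) := [set a |
  (forall x, exists2 A, blocks a A & A (inl x) /\ lower A !=set0) /\
  (forall A x y, blocks a A -> A (inl x) -> A (inl y) -> x = y)].

Definition monoidR : set (setPartition X) := [set a |
  (forall x, exists2 A, blocks a A & A (inr x) /\ upper A !=set0) /\
  (forall A x y, blocks a A -> A (inr x) -> A (inr y) -> x = y)].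

Definition transversal_blocks a : set (set (X + X)) :=
  [set A | [/\ blocks a A, upper A !=set0 & lower A !=set0]].
Definition upper_blocks a : set (set (X + X)) :=
  [set A | blocks a A /\ lower A = set0].
Definition lower_blocks a : set (set (X + X)) :=
  [set A | blocks a A /\ upper A = set0].

Local Open Scope card_scope.

(* There is no type of cardinals: a cardinal is given by a set having that
   cardinality, to be compared by [#<=] and [#=] only. In particular the
   threshold [mu] is any set, with [`I_n] standing for the natural number n,
   and the cardinals k, k^*, d, d^* are given by the sets of blocks
   that they count. *)
Definition kappa a (I : Type) (mu : set I) :=
  [set A | transversal_blocks a A /\ mu #<= upper A].
Definition kappa_star a (I : Type) (mu : set I) :=
  [set A | transversal_blocks a A /\ mu #<= lower A].
Definition delta a (I : Type) (mu : set I) :=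
  [set A | upper_blocks a A /\ mu #<= upper A].
Definition delta_star a (I : Type) (mu : set I) :=
  [set A | lower_blocks a A /\ mu #<= lower A].

Definition defect a := delta a `I_1.
Definition codefect a := delta_star a `I_1.

End BlockCounts.
Arguments monoidL X _ : clear implicits.
Arguments monoidR X _ : clear implicits.

(* A set whose cardinality is |A| + |B|. *)
Definition disjoint_sum (I J : Type) (A : set I) (B : set J) : set (I + J) :=
  inl @` A `|` inr @` B.

(* The condition on (alpha, beta), before any interchange of the two. *)
Definition generating_condition (X : Type) (a b : setPartition X) : Prop :=
  let aleph0 := [set: nat] in
  [/\ monoidL X a, monoidR X b,
      (codefect a #= aleph0)%card, (defect b #= aleph0)%card &
      ((disjoint_sum (kappa_star a `I_2) (delta_star a `I_2) #= aleph0)%card /\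
       (disjoint_sum (kappa b `I_2) (delta b `I_3) #= aleph0)%card) \/
      ((disjoint_sum (kappa_star a `I_2) (delta_star a `I_3) #= aleph0)%card /\
       (disjoint_sum (kappa b `I_2) (delta b `I_2) #= aleph0)%card)].

(* Main.v *)
(** Necessity: a product lies in L only if its first factor does, and in R only
    if its last factor does, so one generator is a nonunit of L and the other one
    a nonunit of R. For each of the properties "has no upper vertex", "has two
    lower vertices" and "has three vertices", the number of blocks having it is
    subadditive under products; for the last one because a component of the
    product graph made of blocks of size at most 2 is a path, with at most two
    outer vertices. Hence one of the generators has infinitely many such blocks.

    Sufficiency: by the involution it is enough to treat (i). Multiplying with
    suitable permutations in between glues infinitely many disjoint finite trees
    or infinite zigzag paths inside the product graph, which yields in turn
    infinitely many transversals with at least two upper vertices, with at least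
    two lower vertices, and finally with infinitely many of both. An element c of
    the last kind suffices: every partition is a product alpha s c t beta with
    permutations s and t, where the infinitely many lower blocks of alpha and
    upper blocks of beta fill up the infinite blocks of c. *)

Require Import Defs.
From mathcomp Require Import all_boot.
From mathcomp Require Import boolp classical_sets functions cardinality.
From Stdlib Require Import Relations.

Set Implicit Arguments.
Unset Strict Implicit.
Unset Printing Implicit Defensive.

Local Open Scope classical_set_scope.

(** * Infinite sets and bijections *)

(** The function takes a membership proof as argument because [U] may be empty, so that no default
    value exists outside [A]. *)
Lemma card_le_elim T U (A : set T) (B : set U) : (A #<= B)%card ->
  exists2 f : forall x, A x -> U, (forall x Ax, B (f x Ax)) &
    forall x y Ax Ay, f x Ax = f y Ay -> x = y.
Proof.
case/card_leP => f; exists (fun x Ax => val (f (SigSub (mem_set Ax)))) => [x Ax|].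
  exact: set_valP.
move=> x y Ax Ay /val_inj/(@inj _ _ _ f).
by rewrite !inE => /(_ I I)/(congr1 val).
Qed.

Lemma card_le_intro T U (A : set T) (B : set U) (f : T -> U) :
  (forall x, A x -> B (f x)) -> (forall x y, A x -> A y -> f x = f y -> x = y) ->
  (A #<= B)%card.
Proof.
move=> fB fi; have /injfunPex[g] : exists2 f : T -> U, set_fun A B f & set_inj A f.
  by exists f => // x y; rewrite !inE; exact: fi.
exact: inj_card_le.
Qed.

Lemma infinite_setE T (A : set T) :
  infinite_set A <-> exists2 f : nat -> T, injective f & forall n, A (f n).
Proof.
rewrite infiniteP; split=> [/card_le_elim[f fA fi]|[f fi fA]].
  by exists (fun n => f n I) => // n m /fi.
by apply: (@card_le_intro _ _ _ _ f) => // x y _ _ /fi.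
Qed.

Lemma card_le_I1 T (B : set T) : (`I_1 #<= B)%card <-> B !=set0.
Proof.
split=> [/card_le_elim[f fB _]|[x Bx]]; first by exists (f 0 isT); exact: fB.
apply: (@card_le_intro _ _ _ _ (fun=> x)) => // i j.
by rewrite /= !ltnS !leqn0 => /eqP-> /eqP->.
Qed.

Lemma card_le_I2 T (B : set T) :
  (`I_2 #<= B)%card <-> exists x y, [/\ x <> y, B x & B y].
Proof.
split=> [/card_le_elim[f fB fi]|[x [y [xy Bx By]]]].
  exists (f 0 isT), (f 1 isT); split; try exact: fB.
  by move/fi.
pose f i := if i is 0 then x else y.
apply: (@card_le_intro _ _ _ _ f) => [[|[|i]]|[|[|i]] [|[|j]]] //= _ _ //.
by move/esym.
Qed.

Lemma card_le_I3 T (B : set T) :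
  (`I_3 #<= B)%card <->
  exists x y z, [/\ x <> y, x <> z & y <> z] /\ [/\ B x, B y & B z].
Proof.
split=> [/card_le_elim[f fB fi]|[x [y [z [[xy xz yz] [Bx By Bz]]]]]].
  exists (f 0 isT), (f 1 isT), (f 2 isT).
  by split; split; try exact: fB; move/fi.
pose f i := match i with 0 => x | 1 => y | _ => z end.
apply: (@card_le_intro _ _ _ _ f) => [[|[|[|i]]]|[|[|[|i]]] [|[|[|j]]]] //= _ _.
all: by try move/esym.
Qed.

Lemma disjoint_sum_aleph0 I J (A : set I) (B : set J) :
  countable A -> countable B ->
  (disjoint_sum A B #= [set: nat])%card <-> infinite_set A \/ infinite_set B.
Proof.
move=> cA cB; split.
  move=> e; apply: contrapT => /not_orP[/contrapT fA /contrapT fB].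
  apply: infinite_nat; rewrite -(eq_finite_set e) finite_setU.
  by split; exact: finite_image.
move=> h; apply: eq_card_nat.
  have [f _ fi] := card_le_elim cA; have [g _ gi] := card_le_elim cB.
  (* Even codes serve [A] and odd codes serve [B]. Outside the two sets [P] asks nothing, so that
     choice yields a total function. *)
  pose P (w : I + J) n := match w with
    | inl x => forall Ax : A x, n = (f x Ax).*2
    | inr y => forall By : B y, n = (g y By).*2.+1 end.
  have [|h' hP] := @choice _ _ P.
    move=> [x|y].
      have [Ax|nA] := pselect (A x); last by exists 0.
      by exists (f x Ax).*2 => A'; rewrite (Prop_irrelevance Ax A').
    have [Ax|nA] := pselect (B y); last by exists 0.
    by exists (g y Ax).*2.+1 => A'; rewrite (Prop_irrelevance Ax A').
  apply: (@card_le_intro _ _ _ _ h') => // u v [[x Ax <-]|[x Ax <-]] [[y Ay <-]|[y Ay <-]].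
  - have /= -> := hP (inl x); have /= -> := hP (inl y).
    by move/double_inj/fi => ->.
  - have /= -> := hP (inl x) Ax; have /= -> := hP (inr y) Ay.
    by move/(congr1 odd); rewrite /= !odd_double.
  - have /= -> := hP (inr x) Ax; have /= -> := hP (inl y) Ay.
    by move/(congr1 odd); rewrite /= !odd_double.
  - have /= -> := hP (inr x) Ax; have /= -> := hP (inr y) Ay.
    by case=> /double_inj/gi => ->.
case: h => h fS; apply: h; apply: card_le_finite fS.
  by apply: (@card_le_intro _ _ _ _ inl) => [x Ax|x y _ _ []//]; left; exists x.
by apply: (@card_le_intro _ _ _ _ inr) => [x Ax|x y _ _ []//]; right; exists x.
Qed.

Lemma card_eq_inverses T (A B : set T) : (A #= B)%card ->
  exists h k : T -> T, (forall x, A x -> B (h x) /\ k (h x) = x) /\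
                       (forall y, B y -> A (k y) /\ h (k y) = y).
Proof.
case/card_bijP => f [g fK gK].
(* [P] and [Q] leave the values outside [A] and [B] free, which turns the bijection of subtypes into
   total functions. *)
pose P x y := forall Ax : A x, y = val (f (SigSub (mem_set Ax))).
pose Q x y := forall Bx : B x, y = val (g (SigSub (mem_set Bx))).
have [|h hP] := @choice _ _ P.
  move=> x; have [Ax|nA] := pselect (A x); last by exists x.
  by exists (val (f (SigSub (mem_set Ax)))) => A'; rewrite (Prop_irrelevance Ax A').
have [|k kP] := @choice _ _ Q.
  move=> x; have [Ax|nA] := pselect (B x); last by exists x.
  by exists (val (g (SigSub (mem_set Ax)))) => A'; rewrite (Prop_irrelevance Ax A').
exists h, k; split=> x Ax.
  have Bh : B (h x) by rewrite (hP x Ax); exact: set_valP.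
  split=> //; rewrite (kP _ Bh).
  have -> : SigSub (mem_set Bh) = f (SigSub (mem_set Ax)).
    by apply: val_inj; rewrite /= (hP x Ax).
  by rewrite fK.
have Bh : A (k x) by rewrite (kP x Ax); exact: set_valP.
split=> //; rewrite (hP _ Bh).
have -> : SigSub (mem_set Bh) = g (SigSub (mem_set Ax)).
  by apply: val_inj; rewrite /= (kP x Ax).
by rewrite gK.
Qed.

(** Outside the prescribed points, the fibres of [f] and [g] over each [n] are both countably
    infinite, so they can be matched fibre by fibre. The labels are thereby preserved by the
    permutation. *)
Lemma extend_bijection X I (f g : X -> nat) (s t : I -> X) :
  countable [set: X] -> injective s -> injective t ->
  (forall i, g (t i) = f (s i)) ->
  (forall n, infinite_set [set x | f x = n /\ ~ range s x]) ->
  (forall n, infinite_set [set x | g x = n /\ ~ range t x]) ->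
  exists p, [/\ bijective p, forall i, p (s i) = t i & forall x, g (p x) = f x].
Proof.
move=> cX si ti st fA gB.
pose A n := [set x | f x = n /\ ~ range s x].
pose B n := [set x | g x = n /\ ~ range t x].
have card_nat (C : set X) : infinite_set C -> (C #= [set: nat])%card.
  move=> iC; apply: eq_card_nat => //; apply: sub_countable cX.
  exact: subset_card_le.
have AB n : (A n #= B n)%card.
  apply: card_eq_trans (card_nat _ (fA n)) _.
  by rewrite card_eq_sym; exact: card_nat (gB n).
have [h H] := choice (fun n => card_eq_inverses (AB n)).
have [k K] := choice H.
(* The graph of the permutation: total and single-valued in both directions. *)
pose R x y := (exists2 i, x = s i & y = t i) \/
  [/\ ~ range s x, ~ range t y, g y = f x & h (f x) x = y].
have Rl x : exists y, R x y.
  have [[i _ <-]|nx] := pselect (range s x); first by exists (t i); left; exists i.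
  exists (h (f x) x); right.
  by have [/(_ x)[//|[gh nt] _]] := K (f x).
have Rr y : exists x, R x y.
  have [[i _ <-]|ny] := pselect (range t y); first by exists (s i); left; exists i.
  exists (k (g y) y); right.
  have [_ /(_ y)[//|[gh nt] e]] := K (g y).
  by split=> //; rewrite gh.
have Rfun x y y' : R x y -> R x y' -> y = y'.
  case=> [[i -> ->]|[nx ny _ <-]].
    by case=> [[j /si -> ->]//|[nx _ _ _]]; case: nx; exists i.
  by case=> [[j xj _]|[_ _ _ <-] //]; case: nx; exists j.
have Rinj x x' y : R x y -> R x' y -> x = x'.
  case=> [[i -> ->]|[nx ny gy e]].
    by case=> [[j -> /ti -> ]//|[_ ny _ _]]; case: ny; exists i.
  case=> [[j _ yj]|[nx' _ gy' e']]; first by case: ny; exists j.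
  have [/(_ x)[//|_ <-] _] := K (f x).
  have [/(_ x')[//|_ <-] _] := K (f x').
  by rewrite e e' -gy -gy'.
have [p pR] := choice Rl; have [q qR] := choice Rr.
exists p; split.
- exists q => x; first exact: Rinj (qR _) (pR _).
  exact: Rfun (pR _) (qR _).
- by move=> i; apply: Rfun (pR _) _; left; exists i.
- by move=> x; case: (pR x) => [[i -> ->]|[]].
Qed.

(** * Products matched by a permutation *)

Section Partitions.
Local Open Scope group_scope.
Variable X : Type.
Implicit Types (a b c : setPartition X) (u v w : X + X).

Lemma same_block_kernel_refl T (l : X + X -> T) : reflexive _ (fun u v => l u = l v).
Proof. by []. Qed.
Lemma same_block_kernel_sym T (l : X + X -> T) : symmetric _ (fun u v => l u = l v).
Proof. by move=> u v; exact: esym. Qed.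
Lemma same_block_kernel_trans T (l : X + X -> T) : transitive _ (fun u v => l u = l v).
Proof. by move=> u v w; exact: etrans. Qed.

Definition kernel T (l : X + X -> T) : setPartition X :=
  of_equiv (@same_block_kernel_refl T l) (@same_block_kernel_sym T l)
           (@same_block_kernel_trans T l).

Lemma same_block_kernel T (l : X + X -> T) u v :
  same_block (kernel l) u v <-> l u = l v.
Proof. exact: same_block_of_equiv. Qed.

Definition push (p : X -> X) u := match u with inl x => inl (p x) | inr y => inr y end.

Definition perm_partition (p : X -> X) :=
  kernel (fun u => match u with inl x => p x | inr y => y end).

Lemma perm_partition_unit p : bijective p -> Sym X (perm_partition p).
Proof.
move=> [q pK qK]; apply/SymE => A /blocksE[u ->].
exists (match u with inl x => x | inr y => q y end).
exists (match u with inl x => p x | inr y => y end).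
apply/seteqP; split=> [v /same_block_kernel|v [->|->]].
- case: u v => [x|x] [y|y] /=.
  + by move/(can_inj pK) => ->; left.
  + by move=> ->; right.
  + by move=> ->; rewrite pK; left.
  + by move=> ->; right.
- by apply/same_block_kernel; case: u => x //=; rewrite qK.
- by apply/same_block_kernel; case: u.
Qed.

(** A permutation on the left only renames the upper vertices of [b], so such a product can be
    handled without its product graph. *)
Lemma same_block_permM p b u v : bijective p ->
  same_block (perm_partition p * b) u v <-> same_block b (push p u) (push p v).
Proof.
move=> [q pK qK]; split.
- move/same_block_mul => j.
  pose f z := match z with
    Upper x => inl (p x) | Middle x => inl x | Lower x => inr x end.
  have fo w : f (outer_emb w) = push p w by case: w.
  rewrite -(fo v).
  apply: (@joined_ind _ _ b (fun z => same_block b (push p u) (f z)) _ _ _ _ j).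
  + by move=> [x|x] [y|y] /same_block_kernel /= ->.
  + by move=> [x|x] [y|y] xy /same_block_trans; exact.
  + by rewrite fo; exact: same_block_refl.
- move=> h; apply/same_block_mul.
  have J w : joined (perm_partition p) b (outer_emb w) (bottom_emb (push p w)).
    case: w => x /=; last exact: rt_refl.
    by apply: (@joined_top _ _ b (inl x) (inr (p x))); apply/same_block_kernel.
  apply: rt_trans (J u) _; apply: rt_trans (joined_bottom _ h) _.
  exact: joined_sym.
Qed.

Definition fits a (l : X + X -> nat) := forall u v, same_block a u v -> l u = l v.

Definition label3 (la lb : X + X -> nat) z := match z with
  Upper x => la (inl x) | Middle x => la (inr x) | Lower x => lb (inr x) end.

(** Labels that agree on the middle row glue to an invariant of the components. This is the tool for
    showing that vertices are not joined. *)
Lemma joined_label a b la lb z z' : fits a la -> fits b lb ->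
  (forall x, la (inr x) = lb (inl x)) ->
  joined a b z z' -> label3 la lb z = label3 la lb z'.
Proof.
move=> fa fb e j.
have T u : label3 la lb (top_emb u) = la u by case: u.
have B u : label3 la lb (bottom_emb u) = lb u by case: u => x /=.
apply: (@joined_ind _ a b (fun y => label3 la lb z = label3 la lb y) _ _ _ _ j) => //.
  by move=> u v /fa; rewrite !T => <-.
by move=> u v /fb; rewrite !B => <-.
Qed.

(** A partial labelling compatible with the blocks is completed by the default 0; only a nonzero
    label therefore certifies [R]. *)
Lemma fits_of_relation a (R : X + X -> nat -> Prop) :
  (forall u v n, same_block a u v -> R u n -> R v n) ->
  (forall u n m, R u n -> R u m -> n = m) ->
  exists2 l, fits a l &
    (forall u n, R u n -> l u = n) /\ forall u, l u <> 0 -> R u (l u).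
Proof.
move=> Rfit Runiq.
have [|l lP] := @choice _ _ (fun u n => R u n \/ n = 0 /\ forall m, ~ R u m).
  move=> u; have [[n h]|nh] := pselect (exists n, R u n); first by exists n; left.
  by exists 0; right; split=> // m h; apply: nh; exists m.
have lE u n : R u n -> l u = n.
  by move=> h; case: (lP u) => [/Runiq/(_ h)//|[_ /(_ n)]].
exists l; last by split=> // u; case: (lP u) => // -[].
move=> u v uv; case: (lP u) => [/(Rfit _ _ _ uv)/lE -> //|[-> nu]].
case: (lP v) => [|[-> //]].
by move/(Rfit _ _ _ (same_block_sym uv))/nu.
Qed.

(* [s i k], for [k : T], are the lower vertices of [a] to be used in the gadget
   number [i]; infinitely many further blocks must remain available to absorb
   the vertices outside the gadgets. *)
Definition spread a T (s : nat -> T -> X) := [/\ forall i, injective (s i),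
  forall i j k k', same_block a (inr (s i k)) (inr (s j k')) -> i = j &
  exists2 f : nat -> X,
    forall n m, same_block a (inr (f n)) (inr (f m)) -> n = m &
    forall i k n, ~ same_block a (inr (s i k)) (inr (f n))].

(** Vertices of gadget [i] get the label [i]. The spare blocks are numbered by pairs [(n, m)], so
    that each label [n] also occurs infinitely often outside the gadgets, as [extend_bijection]
    demands. *)
Lemma spread_label a T (s : nat -> T -> X) : spread a s ->
  exists2 l, fits a l & (forall i k, l (inr (s i k)) = i) /\ forall n,
    infinite_set [set x | l (inr x) = n /\ ~ range (fun ik : nat * T => s ik.1 ik.2) x].
Proof.
move=> [si ss [f fi fs]].
pose R u n := (exists k, same_block a (inr (s n k)) u) \/
  exists m : nat, same_block a (inr (f (pickle (n, m)))) u.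
have Runiq u n n' : R u n -> R u n' -> n = n'.
  case=> -[k su] [] [k' /same_block_sym su'].
  - exact: ss (same_block_trans su su').
  - by case: (fs _ _ _ (same_block_trans su su')).
  - by case: (fs _ _ _ (same_block_sym (same_block_trans su su'))).
  - by have /(pcan_inj pickleK)[] := fi _ _ (same_block_trans su su').
have Rfit u v n : same_block a u v -> R u n -> R v n.
  by move=> uv [] [k h]; [left|right]; exists k; exact: same_block_trans uv.
have [l lf [lE _]] := fits_of_relation Rfit Runiq.
exists l => //; split.
- by move=> i k; apply: lE; left; exists k; exact: same_block_refl.
- move=> n; apply/infinite_setE; exists (fun m => f (pickle (n, m))).
    move=> m m' e; have : same_block a (inr (f (pickle (n, m)))) (inr (f (pickle (n, m')))).
      by rewrite e; exact: same_block_refl.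
    by move/fi/(pcan_inj pickleK) => [].
  move=> m; split; first by apply: lE; right; exists m; exact: same_block_refl.
  case=> -[i k] _ /= e; apply: (fs i k (pickle (n, m))); rewrite e.
  exact: same_block_refl.
Qed.

(** The permutation carries [s i k] to [t i k], so each gadget is assembled from blocks of [a] and
    [b] as prescribed. The label [L] keeps different gadgets in different components. *)
Lemma matched_product (cX : countable [set: X]) a b T (s t : nat -> T -> X) :
  spread a s -> spread (pstar b) t ->
  exists2 p, bijective p & let b' := perm_partition p * b in
  [/\ forall i k i' k', same_block b (inl (t i k)) (inl (t i' k')) ->
        joined a b' (Middle (s i k)) (Middle (s i' k')),
      forall i k y, same_block b (inl (t i k)) (inr y) ->
        joined a b' (Middle (s i k)) (Lower y) &
      exists2 L : vertex3 X -> nat,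
        forall z z', joined a b' z z' -> L z = L z' &
        forall i k, L (Middle (s i k)) = i].
Proof.
have fl (c : setPartition X) r : spread c r ->
    injective (fun ik : nat * T => r ik.1 ik.2).
  case=> ri rs _ [i k] [j k'] /= e.
  have ij : i = j by apply: (rs i j k k'); rewrite e; exact: same_block_refl.
  by subst j; rewrite (ri _ _ _ e).
move=> sa sb; have [la laf [las lai]] := spread_label sa.
have [lb lbf [lbs lbi]] := spread_label sb.
have [|p [pb ps lab]] := extend_bijection cX (fl _ _ sa) (fl _ _ sb) _ lai lbi.
  by case=> i k /=; rewrite las lbs.
exists p => //=; split.
- move=> i k i' k' h; apply: (@joined_bottom _ a _ (inl _) (inl _)).
  by apply/(same_block_permM _ _ _ pb); rewrite /= (ps (i, k)) (ps (i', k')).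
- move=> i k y h; apply: (@joined_bottom _ a _ (inl _) (inr _)).
  by apply/(same_block_permM _ _ _ pb); rewrite /= (ps (i, k)).
(* The label [lb] was built for [pstar b], hence the flip; [push p] transports it to
   [perm_partition p * b]. *)
- exists (label3 la (fun u => lb (flip (push p u)))).
    move=> z z'; apply: joined_label => //; last by move=> x; rewrite -lab.
    move=> u v /(same_block_permM _ _ _ pb) h; apply: lbf.
    by apply/same_block_star; rewrite !flipK.
  by move=> i k; exact: las.
Qed.

End Partitions.

(** * Gadgets in the product graph *)

Section Gadgets.
Local Open Scope group_scope.
Variable X : Type.
Hypothesis cX : countable [set: X].
Implicit Types (a b c : setPartition X) (u v w : X + X) (S : set (set (X + X))).

(** Any countable index type is allowed: the gadgets index their blocks by pairs and sums, with a
    summand reserved for spare blocks. *)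
Lemma infinite_family (J : countType) a S : S `<=` blocks a -> infinite_set S ->
  exists2 v : J -> X + X, forall i j, same_block a (v i) (v j) -> i = j &
    forall j, S (same_block a (v j)).
Proof.
move=> Sa /infinite_setE[f fi fS].
have /choice[r rP] : forall n, exists r, f n = same_block a r.
  by move=> n; apply/blocksE; exact: Sa.
exists (fun j => r (pickle j)) => [i j ij|j]; last by rewrite -rP.
apply: (pcan_inj pickleK); apply: fi.
apply: (@block_uniq _ a _ _ (r (pickle j))); try exact: Sa; rewrite rP //.
exact: same_block_refl.
Qed.

Lemma family_infinite a S (v : nat -> X + X) :
  (forall i j, same_block a (v i) (v j) -> i = j) ->
  (forall j, S (same_block a (v j))) -> infinite_set S.
Proof.
move=> vi vS; apply/infinite_setE; exists (fun n => same_block a (v n)) => // i j e.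
by apply: vi; rewrite e; exact: same_block_refl.
Qed.

(** * Block counts under the involution *)

Lemma blocks_star a A : blocks (pstar a) (@flip X @^-1` A) <-> blocks a A.
Proof.
have st c B : blocks c B -> blocks (pstar c) (@flip X @^-1` B).
  move=> /blocksE[u ->]; apply/blocksE; exists (flip u).
  by apply/seteqP; split=> v; rewrite same_block_star flipK.
split=> [/st|/st//]; rewrite pstarK.
have -> // : @flip X @^-1` (@flip X @^-1` A) = A.
by apply/seteqP; split=> v /=; rewrite flipK.
Qed.

Lemma infinite_flip S S' : (forall A, S A -> S' (@flip X @^-1` A)) ->
  infinite_set S -> infinite_set S'.
Proof.
move=> SS' /infinite_setE[f fi fS]; apply/infinite_setE.
exists (fun n => @flip X @^-1` (f n)) => [n m e|n]; last exact: SS'.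
apply: fi; apply/seteqP; split=> u.
  by have := congr1 (fun A => A (flip u)) e; rewrite /= flipK => ->.
by have := congr1 (fun A => A (flip u)) e; rewrite /= flipK => ->.
Qed.

Lemma infinite_kappa_star a I (mu : set I) :
  infinite_set (kappa_star (pstar a) mu) <-> infinite_set (kappa a mu).
Proof.
have H c : infinite_set (kappa c mu) -> infinite_set (kappa_star (pstar c) mu).
  by apply: infinite_flip => A [[Ac uA lA] h]; split=> //; split=> //; apply/blocks_star.
split=> [|/H//].
rewrite -{2}[a]pstarK; move: (pstar a) => c.
by apply: infinite_flip => A [[Ac uA lA] h]; split=> //; split=> //; apply/blocks_star.
Qed.

Lemma infinite_delta_star a I (mu : set I) :
  infinite_set (delta_star (pstar a) mu) <-> infinite_set (delta a mu).
Proof.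
have H c : infinite_set (delta c mu) -> infinite_set (delta_star (pstar c) mu).
  by apply: infinite_flip => A [[Ac uA] h]; split=> //; split=> //; apply/blocks_star.
split=> [|/H//].
rewrite -{2}[a]pstarK; move: (pstar a) => c.
by apply: infinite_flip => A [[Ac uA] h]; split=> //; split=> //; apply/blocks_star.
Qed.

Lemma infinite_transversal_star a :
  infinite_set (transversal_blocks (pstar a)) <-> infinite_set (transversal_blocks a).
Proof.
have H c : infinite_set (transversal_blocks c) -> infinite_set (transversal_blocks (pstar c)).
  by apply: infinite_flip => A [Ac uA lA]; split=> //; apply/blocks_star.
by split=> /H; rewrite ?pstarK.
Qed.

(** * Vertices chosen in infinitely many blocks *)

Lemma transversal_family (J : countType) a : infinite_set (transversal_blocks a) ->
  exists U V : J -> X, (forall j, same_block a (inr (V j)) (inl (U j))) /\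
    forall i j, same_block a (inr (V i)) (inr (V j)) -> i = j.
Proof.
have sa : transversal_blocks a `<=` blocks a by move=> A [].
case/(infinite_family J sa) => v vi vS.
have /choice[U UP] : forall j, exists U, same_block a (v j) (inl U).
  by move=> j; case: (vS j).
have /choice[V VP] : forall j, exists V, same_block a (v j) (inr V).
  by move=> j; case: (vS j).
exists U, V; split=> [j|i j ij]; first exact: same_block_trans (same_block_sym (VP _)) _.
by apply: vi; apply: same_block_trans (VP i) (same_block_trans ij (same_block_sym (VP j))).
Qed.

Lemma kappa_star2_family (J : countType) a : infinite_set (kappa_star a `I_2) ->
  exists U V W : J -> X, [/\ forall j, same_block a (inr (V j)) (inl (U j)),
    forall j, same_block a (inr (V j)) (inr (W j)), forall j, V j <> W j &
    forall i j, same_block a (inr (V i)) (inr (V j)) -> i = j].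
Proof.
have sa : kappa_star a `I_2 `<=` blocks a by move=> A [[]].
case/(infinite_family J sa) => v vi vS.
have /choice[U UP] : forall j, exists U, same_block a (v j) (inl U).
  by move=> j; case: (vS j) => -[].
have /choice[V VP] : forall j, exists V, exists W, [/\ V <> W,
    same_block a (v j) (inr V) & same_block a (v j) (inr W)].
  by move=> j; case: (vS j) => _ /card_le_I2.
have [W WP] := choice VP; exists U, V, W; split=> [j|j|j|i j ij].
- by case: (WP j) => _ /same_block_sym/same_block_trans h _; exact: h.
- by case: (WP j) => _ /same_block_sym/same_block_trans h; exact: h.
- by case: (WP j).
- case: (WP i) (WP j) => _ Vi _ [_ /same_block_sym Vj _].
  by apply: vi; exact: same_block_trans Vi (same_block_trans ij Vj).
Qed.

Lemma delta_star2_family (J : countType) a : infinite_set (delta_star a `I_2) ->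
  exists V W : J -> X, [/\ forall j x, ~ same_block a (inr (V j)) (inl x),
    forall j, same_block a (inr (V j)) (inr (W j)), forall j, V j <> W j &
    forall i j, same_block a (inr (V i)) (inr (V j)) -> i = j].
Proof.
have sa : delta_star a `I_2 `<=` blocks a by move=> A [[]].
case/(infinite_family J sa) => v vi vS.
have /choice[V VP] : forall j, exists V, exists W, [/\ V <> W,
    same_block a (v j) (inr V) & same_block a (v j) (inr W)].
  by move=> j; case: (vS j) => _ /card_le_I2.
have [W WP] := choice VP; exists V, W; split=> [j x|j|j|i j ij].
- case: (WP j) => _ /same_block_trans h _ /h vx.
  by case: (vS j) => -[_ e] _; have : set0 x by rewrite -e.
- by case: (WP j) => _ /same_block_sym/same_block_trans h; exact: h.
- by case: (WP j).
- case: (WP i) (WP j) => _ Vi _ [_ /same_block_sym Vj _].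
  by apply: vi; exact: same_block_trans Vi (same_block_trans ij Vj).
Qed.

Lemma delta_star3_family (J : countType) a : infinite_set (delta_star a `I_3) ->
  exists V W Z : J -> X, [/\ forall j x, ~ same_block a (inr (V j)) (inl x),
    forall j, same_block a (inr (V j)) (inr (W j)) /\
              same_block a (inr (V j)) (inr (Z j)),
    forall j, [/\ V j <> W j, V j <> Z j & W j <> Z j] &
    forall i j, same_block a (inr (V i)) (inr (V j)) -> i = j].
Proof.
have sa : delta_star a `I_3 `<=` blocks a by move=> A [[]].
case/(infinite_family J sa) => v vi vS.
have /choice[V VP] : forall j, exists V, exists W Z, [/\ V <> W, V <> Z & W <> Z] /\
    [/\ same_block a (v j) (inr V), same_block a (v j) (inr W) &
        same_block a (v j) (inr Z)].
  by move=> j; case: (vS j) => _ /card_le_I3.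
have [W WP] := choice VP; have [Z ZP] := choice WP.
exists V, W, Z; split=> [j x|j|j|i j ij].
- case: (ZP j) => _ [/same_block_trans h _ _] /h vx.
  by case: (vS j) => -[_ e] _; have : set0 x by rewrite -e.
- by case: (ZP j) => _ [/same_block_sym/same_block_trans h Vw Vz]; split; exact: h.
- by case: (ZP j).
- case: (ZP i) (ZP j) => _ [Vi _ _] [_ [/same_block_sym Vj _ _]].
  by apply: vi; exact: same_block_trans Vi (same_block_trans ij Vj).
Qed.

(** Here [v] represents distinct blocks indexed by [J], [bt i k] names the block that contains
    [s i k], and [ph] lists the blocks kept in reserve. *)
Lemma spread_intro a T J (v : J -> X) (bt : nat -> T -> J) (ph : nat -> J) s :
  (forall i j, same_block a (inr (v i)) (inr (v j)) -> i = j) ->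
  (forall i k, same_block a (inr (v (bt i k))) (inr (s i k))) ->
  (forall i j k k', bt i k = bt j k' -> i = j) ->
  (forall i k k', bt i k = bt i k' -> s i k = s i k' -> k = k') ->
  injective ph -> (forall i k n, bt i k <> ph n) -> spread a s.
Proof.
move=> vi vs bti bts phi btph.
have sv i j k k' : same_block a (inr (s i k)) (inr (s j k')) -> bt i k = bt j k'.
  move=> h; apply: vi; apply: same_block_trans (vs i k) _.
  exact: same_block_trans h (same_block_sym (vs j k')).
split.
- move=> i k k' e; apply: (bts i) => //; apply: sv; rewrite e.
  exact: same_block_refl.
- by move=> i j k k' /sv/bti.
- exists (fun n => v (ph n)); first by move=> n m /vi/phi.
  move=> i k n h; apply: (btph i k n); apply: vi.
  exact: same_block_trans (vs i k) h.
Qed.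

Definition bilateral_blocks c := [set A | [/\ blocks c A, infinite_set (upper A) &
  infinite_set (lower A)]].

(* The gadgets are zigzag paths alternating between the transversals of [a] and
   those of [b]. *)
Lemma zigzag a b : infinite_set (kappa_star a `I_2) -> infinite_set (kappa b `I_2) ->
  exists2 p, bijective p & infinite_set (bilateral_blocks (a * (perm_partition p * b))).
Proof.
pose J : countType := (nat * nat + nat)%type.
move=> /(kappa_star2_family J)[U [V [W [VU VW nVW Vi]]]].
move=> /infinite_kappa_star/(kappa_star2_family J)[U' [V' [W' [VU' VW' nVW' Vi']]]].
(* In gadget [i], the block number [n] of [b] is glued to the vertex [V] of block [n] of [a] and to
   the vertex [W] of block [n.+1], which makes the path go on forever. *)
pose bs (i : nat) (k : nat * bool) : J := inl (i, if k.2 then k.1.+1 else k.1).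
pose s i k := (if k.2 then W else V) (bs i k).
pose bt (i : nat) (k : nat * bool) : J := inl (i, k.1).
pose t i (k : nat * bool) := (if k.2 then W' else V') (bt i k).
have sa : spread a s.
  apply: (@spread_intro _ _ J V bs inr).
  - by [].
  - by move=> i [n []]; rewrite /s //=; exact: same_block_refl.
  - by move=> i j k k' [].
  - move=> i [n c] [n' c'] e; rewrite /s e; case: c c' e => [] [] //= [] => [[->]|e|e|->] //.
      by move/esym/nVW.
    by move/nVW.
  - by move=> n m [].
  - by [].
have tb : spread (pstar b) t.
  apply: (@spread_intro _ _ J V' bt inr).
  - by [].
  - by move=> i [n []]; rewrite /t //=; exact: same_block_refl.
  - by move=> i j k k' [].
  - move=> i [n c] [n' c'] e; rewrite /t e; case: c c' e => [] [] //= [-> //].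
      by move/esym/nVW'.
    by move/nVW'.
  - by move=> n m [].
  - by [].
have [p pb [J1 J2 [L Lj Ls]]] := matched_product cX sa tb.
exists p => //; set b' := perm_partition p * b in J1 J2 Lj *.
have JU i n : joined a b' (Middle (V (inl (i, n)))) (Upper (U (inl (i, n)))).
  exact: (@joined_top _ a b' (inr _) (inl _) (VU _)).
have JV i n : joined a b' (Middle (V (inl (i, 0)))) (Middle (V (inl (i, n)))).
  elim: n => [|n ih]; first exact: rt_refl.
  apply: rt_trans ih _; apply: rt_trans (J1 i (n, false) i (n, true) _) _.
    by have /same_block_star := VW' (inl (i, n)).
  by apply: joined_sym; apply: (@joined_top _ a b' (inr _) (inr _)).
apply: (@family_infinite (a * b') _ (fun i => inl (U (inl (i, 0))))).
  move=> i j /same_block_mul ij.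
  have e k : L (Upper (U (inl (k, 0)))) = k.
    by rewrite -(Lj _ _ (JU k 0)); exact: (Ls k (0, false)).
  by rewrite -(e i) -(e j); exact: Lj.
move=> i; have JT n : joined a b' (Upper (U (inl (i, 0)))) (Middle (V (inl (i, n)))).
  by apply: rt_trans (joined_sym (JU _ _)) (JV _ _).
split; first by apply/blocksE; eexists.
- apply/infinite_setE; exists (fun n => U (inl (i, n))) => [n m e|n].
    have : same_block a (inr (V (inl (i, n)))) (inr (V (inl (i, m)))).
      by apply: same_block_trans (VU _) (same_block_sym _); rewrite e; exact: VU.
    by move/Vi => [].
  by apply/same_block_mul; exact: rt_trans (JT n) (JU _ _).
- apply/infinite_setE; exists (fun n => U' (inl (i, n))) => [n m e|n].
    have : same_block (pstar b) (inr (V' (inl (i, n)))) (inr (V' (inl (i, m)))).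
      by apply: same_block_trans (VU' _) (same_block_sym _); rewrite e; exact: VU'.
    by move/Vi' => [].
  apply/same_block_mul; apply: rt_trans (JT n) (J2 i (n, false) _ _).
  by have /same_block_star := VU' (inl (i, n)).
Qed.

Lemma sum_separated a (I J : Type) (V1 : I -> X) (V2 : J -> X) (U : I -> X) :
  (forall i, same_block a (inr (V1 i)) (inl (U i))) ->
  (forall j x, ~ same_block a (inr (V2 j)) (inl x)) ->
  (forall i i', same_block a (inr (V1 i)) (inr (V1 i')) -> i = i') ->
  (forall j j', same_block a (inr (V2 j)) (inr (V2 j')) -> j = j') ->
  forall k k' : I + J,
    same_block a (inr (match k with inl i => V1 i | inr j => V2 j end))
                 (inr (match k' with inl i => V1 i | inr j => V2 j end)) -> k = k'.
Proof.
move=> VU nV i1 i2 [i|j] [i'|j'] h.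
- by rewrite (i1 _ _ h).
- by case: (nV j' (U i)); exact: same_block_trans (same_block_sym h) (VU _).
- by case: (nV j (U i')); exact: same_block_trans h (VU _).
- by rewrite (i2 _ _ h).
Qed.

(* Each gadget is a path from a transversal of [a] through a transversal of [b]
   and a lower block of [a] to a second transversal of [b]. *)
Lemma widen_lower a b : infinite_set (transversal_blocks a) ->
  infinite_set (delta_star a `I_2) -> infinite_set (kappa b `I_2) ->
  exists2 p, bijective p & infinite_set (kappa_star (a * (perm_partition p * b)) `I_2).
Proof.
move=> /(transversal_family (nat + nat)%type)[U [V [VU Vi]]].
move=> /(delta_star2_family nat)[K [K' [Kx KK nK Ki]]].
pose J : countType := (nat * bool + nat)%type.
move=> /infinite_kappa_star/(kappa_star2_family J)[U' [V' [W' [VU' VW' nVW' Vi']]]].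
pose bs (i : nat) (k : option bool) : (nat + nat) + nat :=
  if k is None then inl (inl i) else inr i.
pose s i k := match k with
  None => V (inl i) | Some false => K i | Some true => K' i end.
(* The first transversal of [b] meets [V] and [K]; the other vertex [K'] of the lower block of [a]
   meets the second transversal. *)
pose bt (i : nat) (k : option bool) : J :=
  if k is Some true then inl (i, true) else inl (i, false).
pose t (i : nat) k := match k with
  None => V' (inl (i, false)) | Some false => W' (inl (i, false))
  | Some true => V' (inl (i, true)) end.
have sa : spread a s.
  apply: (@spread_intro _ _ _
    (fun k => match k with inl i => V i | inr j => K j end) bs (fun n => inl (inr n))).
  - exact: sum_separated VU Kx Vi Ki.
  - by move=> i [[]|] //=; exact: same_block_refl.
  - by move=> i j [k|] [k'|] [].
  - by move=> i [[]|] [[]|] //= _; [move/esym/nK|move/nK].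
  - by move=> n m [].
  - by move=> i [k|].
have tb : spread (pstar b) t.
  apply: (@spread_intro _ _ J V' bt inr).
  - by [].
  - by move=> i [[]|] //=; exact: same_block_refl.
  - by move=> i j [[]|] [[]|] [].
  - by move=> i [[]|] [[]|] //= _; [move/esym/nVW'|move/nVW'].
  - by move=> n m [].
  - by move=> i [[]|].
have [p pb [J1 J2 [L Lj Ls]]] := matched_product cX sa tb.
exists p => //; set b' := perm_partition p * b in J1 J2 Lj *.
have JU i : joined a b' (Upper (U (inl i))) (Middle (V (inl i))).
  exact/joined_sym/(@joined_top _ a b' (inr _) (inl _) (VU _)).
have JF i : joined a b' (Middle (V (inl i))) (Middle (K i)).
  apply: (J1 i None i (Some false)).
  by have /same_block_star := VW' (inl (i, false)).
have JT i : joined a b' (Middle (V (inl i))) (Middle (K' i)).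
  by apply: rt_trans (JF i) _; exact: (@joined_top _ a b' (inr _) (inr _) (KK i)).
apply: (@family_infinite (a * b') _ (fun i => inl (U (inl i)))).
  move=> i j /same_block_mul ij.
  have e k : L (Upper (U (inl k))) = k.
    by rewrite (Lj _ _ (JU k)); exact: (Ls k None).
  by rewrite -(e i) -(e j); exact: Lj.
move=> i.
have LF : same_block (a * b') (inl (U (inl i))) (inr (U' (inl (i, false)))).
  apply/same_block_mul; apply: rt_trans (JU i) (J2 i None _ _).
  by have /same_block_star := VU' (inl (i, false)).
have LT : same_block (a * b') (inl (U (inl i))) (inr (U' (inl (i, true)))).
  apply/same_block_mul; apply: rt_trans (JU i) _.
  apply: rt_trans (JT i) (J2 i (Some true) _ _).
  by have /same_block_star := VU' (inl (i, true)).
split; first split.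
- by apply/blocksE; eexists.
- by exists (U (inl i)); exact: same_block_refl.
- by eexists; exact: LF.
apply/card_le_I2; exists (U' (inl (i, false))), (U' (inl (i, true))); split=> // e.
suff : inl (i, false) = inl (i, true) :> J by [].
apply: Vi'; apply: same_block_trans (VU' _) (same_block_sym _); rewrite e.
exact: VU'.
Qed.

(* Each gadget is a tree in which an upper block of [b] of size 3 is attached to
   two transversals of [a] and, through a lower block of [a], to a transversal
   of [b]. *)
Lemma branch_upper a b : infinite_set (transversal_blocks a) ->
  infinite_set (delta_star a `I_2) -> infinite_set (transversal_blocks b) ->
  infinite_set (delta b `I_3) ->
  exists2 p, bijective p & infinite_set (kappa (a * (perm_partition p * b)) `I_2).
Proof.
move=> /(transversal_family (nat * bool)%type)[U [V [VU Vi]]].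
move=> /(delta_star2_family (nat + nat)%type)[K [K' [Kx KK nK Ki]]].
move=> /infinite_transversal_star/(transversal_family nat)[U' [V' [VU' Vi']]].
move=> /infinite_delta_star/(delta_star3_family (nat + nat)%type).
move=> [D [D' [D'' [Dx DD nD Di]]]].
pose bs i (k : bool * bool) : (nat * bool) + (nat + nat) :=
  if k.1 then inl (i, k.2) else inr (inl i).
pose s (i : nat) (k : bool * bool) := match k with
  (true, c) => V (i, c) | (false, false) => K (inl i) | (false, true) => K' (inl i) end.
pose bt (i : nat) (k : bool * bool) : nat + (nat + nat) :=
  if k is (false, false) then inl i else inr (inl i).
(* The three vertices of the upper block of [b] meet [K'] and the two transversals of [a], while [K]
   meets the transversal of [b]. *)
pose t (i : nat) (k : bool * bool) := match k with
  (false, false) => V' i | (false, true) => D (inl i) | (true, false) => D' (inl i)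
  | (true, true) => D'' (inl i) end.
have sa : spread a s.
  apply: (@spread_intro _ _ _
    (fun k => match k with inl i => V i | inr j => K j end) bs (fun n => inr (inr n))).
  - exact: sum_separated VU Kx Vi Ki.
  - by move=> i [[] []] //=; exact: same_block_refl.
  - by move=> i j [[] c] [[] c'] [].
  - by move=> i [[] []] [[] []] // _ => [/esym|] /nK.
  - by move=> n m [].
  - by move=> i [[] []].
have tb : spread (pstar b) t.
  apply: (@spread_intro _ _ _
    (fun k => match k with inl i => V' i | inr j => D j end) bt (fun n => inr (inr n))).
  - exact: sum_separated VU' Dx Vi' Di.
  - by move=> i [[] []] //=; try exact: same_block_refl; case: (DD (inl i)).
  - by move=> i j [[] []] [[] []] [].
  - move=> i; case: (nD (inl i)) => n12 n13 n23.
    by move=> [[] []] [[] []] h e; first [done | by case: n12 | by case: n13 | by case: n23].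
  - by move=> n m [].
  - by move=> i [[] []].
have [p pb [J1 J2 [L Lj Ls]]] := matched_product cX sa tb.
exists p => //; set b' := perm_partition p * b in J1 J2 Lj *.
have JU i (c0 : bool) : joined a b' (Upper (U (i, c0))) (Middle (V (i, c0))).
  exact/joined_sym/(@joined_top _ a b' (inr _) (inl _) (VU _)).
have JF i : joined a b' (Middle (K' (inl i))) (Middle (V (i, false))).
  apply: (J1 i (false, true) i (true, false)).
  by have [/same_block_star] := DD (inl i).
have JT i : joined a b' (Middle (K' (inl i))) (Middle (V (i, true))).
  apply: (J1 i (false, true) i (true, true)).
  by have [_ /same_block_star] := DD (inl i).
have JK i : joined a b' (Middle (K (inl i))) (Middle (K' (inl i))).
  exact: (@joined_top _ a b' (inr _) (inr _) (KK _)).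
apply: (@family_infinite (a * b') _ (fun i => inl (U (i, false)))).
  move=> i j /same_block_mul ij.
  have e k : L (Upper (U (k, false))) = k.
    by rewrite (Lj _ _ (JU k false)); exact: (Ls k (true, false)).
  by rewrite -(e i) -(e j); exact: Lj.
move=> i.
have UF : joined a b' (Upper (U (i, false))) (Middle (K' (inl i))).
  exact: rt_trans (JU _ _) (joined_sym (JF i)).
have LT : same_block (a * b') (inl (U (i, false))) (inl (U (i, true))).
  apply/same_block_mul; apply: rt_trans UF (rt_trans _ _ _ _ _ (JT i) (joined_sym (JU _ _))).
have LL : same_block (a * b') (inl (U (i, false))) (inr (U' i)).
  apply/same_block_mul; apply: rt_trans UF (rt_trans _ _ _ _ _ (joined_sym (JK i)) _).
  apply: (J2 i (false, false)).
  by have /same_block_star := VU' i.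
split; first split.
- by apply/blocksE; eexists.
- by exists (U (i, false)); exact: same_block_refl.
- by eexists; exact: LL.
apply/card_le_I2; exists (U (i, false)), (U (i, true)).
split=> [e| |]; [|exact: same_block_refl|exact: LT].
suff : (i, false) = (i, true) :> nat * bool by [].
apply: Vi; apply: same_block_trans (VU _) (same_block_sym _); rewrite e.
exact: VU.
Qed.

End Gadgets.

(** * Factorization through infinite blocks *)

Section Absorption.
Local Open Scope group_scope.
Variable X : Type.
Hypothesis cX : countable [set: X].
Implicit Types (a b c : setPartition X) (u v w : X + X).

Lemma monoidLP a : monoidL X a <->
  (forall x, exists y, same_block a (inl x) (inr y)) /\
  (forall x y, same_block a (inl x) (inl y) -> x = y).
Proof.
split=> [[E I]|[E I]]; split.
- by move=> x; have [A PA [Ax [y Ay]]] := E x; exists y, A.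
- by move=> x y [A PA [Ax Ay]]; exact: I PA Ax Ay.
- by move=> x; have [y [A PA [Ax Ay]]] := E x; exists A => //; split=> //; exists y.
- by move=> A x y PA Ax Ay; apply: I; exists A.
Qed.

Lemma monoidL_star a : monoidL X (pstar a) <-> monoidR X a.
Proof.
split=> [/monoidLP[E I]|[E I]].
  split=> [x|A x y PA Ax Ay]; last by apply: I; apply/same_block_star; exists A.
  have [y /same_block_star[A PA [Ax Ay]]] := E x.
  by exists A => //; split=> //; exists y.
apply/monoidLP; split=> [x|x y /same_block_star[A PA [Ax Ay]]]; last exact: I PA Ax Ay.
have [A PA [Ax [y Ay]]] := E x; exists y; apply/same_block_star.
by exists A.
Qed.

Lemma monoidL_transversal a : infinite_set [set: X] -> monoidL X a ->
  infinite_set (transversal_blocks a).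
Proof.
move=> /infinite_setE[f fi _] /monoidLP[E I].
apply: (@family_infinite _ a _ (fun n => inl (f n))) => [i j /I/fi //|n].
split; first by apply/blocksE; eexists.
  by exists (f n); exact: same_block_refl.
by have [y] := E (f n); exists y.
Qed.

Lemma codefect_family a : infinite_set (codefect a) -> exists D : nat -> X,
  (forall n x, ~ same_block a (inr (D n)) (inl x)) /\
  (forall n m, same_block a (inr (D n)) (inr (D m)) -> n = m).
Proof.
have sa : codefect a `<=` blocks a by move=> A [[]].
case/(infinite_family nat sa) => v vi vS.
have /choice[D DP] : forall n, exists D, same_block a (v n) (inr D).
  by move=> n; have [_ /card_le_I1] := vS n.
exists D; split=> [n x|n m h].
  move/(same_block_trans (DP n)) => vx.
  by have [[_ e] _] := vS n; have : set0 x by rewrite -e.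
by apply: vi; apply: same_block_trans (DP n) (same_block_trans h (same_block_sym (DP m))).
Qed.

(* The label 0 stands for a junk region in which nothing is known. *)
Definition exact_label c (l : X + X -> nat) :=
  fits c l /\ forall u v, l u = l v -> l u <> 0 -> same_block c u v.

Lemma exact_label_star c l : exact_label c l -> exact_label (pstar c) (fun u => l (flip u)).
Proof.
move=> [lf le]; split=> [u v /same_block_star/lf //|u v e n0].
by apply/same_block_star; exact: le.
Qed.

Lemma exact_label_perm p c l : bijective p -> exact_label c l ->
  exact_label (perm_partition p * c) (fun u => l (push p u)).
Proof.
move=> pb [lf le]; split=> [u v /(same_block_permM _ _ _ pb)/lf //|u v e n0].
by apply/(same_block_permM _ _ _ pb); exact: le.
Qed.

(** Every outer vertex is joined, without change of label, to a vertex of the graph of [c];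
    exactness is then inherited from [c], and [la] only has to fit. *)
Lemma exact_label_mul a c la l : fits a la ->
  (forall x, exists y, same_block a (inl x) (inr y)) -> exact_label c l ->
  (forall x, la (inr x) = l (inl x)) ->
  exact_label (a * c) (fun u => match u with inl x => la (inl x) | inr y => l (inr y) end).
Proof.
move=> fa aE [lf le] e; set lac := fun u => _.
have lacE u : lac u = label3 la l (outer_emb u) by case: u.
split=> [u v /same_block_mul/(joined_label fa lf e)|u v uv u0]; first by rewrite !lacE.
have J w : exists2 z, joined a c (outer_emb w) (bottom_emb z) & l z = lac w.
  case: w => x; last by exists (inr x) => //; exact: rt_refl.
  have [y xy] := aE x; exists (inl y); first exact: joined_top xy.
  by rewrite -e -(fa _ _ xy).
have [z jz lz] := J u; have [z' jz' lz'] := J v.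
apply/same_block_mul; apply: rt_trans jz _; apply: rt_trans _ (joined_sym jz').
by apply: joined_bottom; apply: le; rewrite lz ?lz'.
Qed.

(** The upper vertices lie in distinct blocks of [a], so [g] can be arbitrary. The lower blocks,
    numbered by pairs, make every label occur infinitely often below. *)
Lemma absorbing_label a (g : X -> nat) : monoidL X a -> infinite_set (codefect a) ->
  exists2 la, fits a la & (forall x, la (inl x) = g x) /\
    forall n, infinite_set [set y | la (inr y) = n].
Proof.
move=> /monoidLP[_ I] /codefect_family[D [Dx Di]].
pose R u n := (exists2 x, same_block a (inl x) u & n = g x) \/
  exists m : nat, same_block a (inr (D (pickle (n, m)))) u.
have Rfit u v n : same_block a u v -> R u n -> R v n.
  move=> uv [[x xu ->]|[m h]]; [left; exists x => //|right; exists m];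
    exact: same_block_trans uv.
have Runiq u n m : R u n -> R u m -> n = m.
  case=> [[x xu ->]|[k ku]] [[y /same_block_sym yu ->]|[k' /same_block_sym ku']].
  - by rewrite (I _ _ (same_block_trans xu yu)).
  - by case: (Dx _ _ (same_block_sym (same_block_trans xu ku'))).
  - by case: (Dx _ _ (same_block_trans ku yu)).
  - by have /(pcan_inj pickleK)[] := Di _ _ (same_block_trans ku ku').
have [l lf [lE _]] := fits_of_relation Rfit Runiq.
exists l => //; split=> [x|n].
  by apply: lE; left; exists x => //; exact: same_block_refl.
apply/infinite_setE; exists (fun m => D (pickle (n, m))) => [m m' e|m].
  have : same_block a (inr (D (pickle (n, m)))) (inr (D (pickle (n, m')))).
    by rewrite e; exact: same_block_refl.
  by move/Di/(pcan_inj pickleK) => [].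
by apply: lE; right; exists m; exact: same_block_refl.
Qed.

(** This replaces the upper labels of [c] by any prescribed ones and keeps the lower labels. *)
Lemma absorb a c l (g : X -> nat) : monoidL X a -> infinite_set (codefect a) ->
  exact_label c l -> (forall n, infinite_set [set x | l (inl x) = n]) ->
  exists2 p, bijective p & exact_label (a * (perm_partition p * c))
    (fun u => match u with inl x => g x | inr y => l (inr y) end).
Proof.
move=> La da cl li; have [la laf [lag lai]] := absorbing_label g La da.
(* No points are prescribed: the middle rows are matched by labels alone. *)
pose s (i : void) : X := match i with end.
have [|||||p [pb _ lp]] := @extend_bijection X void (fun x => la (inr x)) (fun x => l (inl x)) s s cX.
- by case.
- by case.
- by case.
- by move=> n; apply: sub_infinite_set (lai n) => x /= xn; split=> // -[[]].
- by move=> n; apply: sub_infinite_set (li n) => x /= xn; split=> // -[[]].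
exists p => //.
have /monoidLP[aE _] := La.
have := exact_label_mul laf aE (exact_label_perm pb cl) (fun x => esym (lp x)).
congr exact_label; apply/funext; case=> //=.
Qed.

Lemma countable_blocks c : countable (blocks c).
Proof.
have -> : blocks c = range (fun u => same_block c u).
  by apply/seteqP; split=> A; [move=> /blocksE[u ->]; exists u|case=> u _ <-; apply/blocksE; exists u].
apply: sub_countable (card_image_le _ _) _.
have [f _ fi] := card_le_elim cX.
apply: (@card_le_intro _ _ _ _ (fun u : X + X =>
  pickle (match u with inl x => (true, f x I) | inr x => (false, f x I) end))) => //.
by move=> [x|x] [y|y] _ _ /(pcan_inj pickleK)// [] /fi ->.
Qed.

(** The labels avoid 0, the label of the junk region. *)
Lemma partition_label c : exists2 g : X + X -> nat,
  (forall u, g u <> 0) & forall u v, same_block c u v <-> g u = g v.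
Proof.
have [f _ fi] := card_le_elim (countable_blocks c).
have B u : blocks c (same_block c u) by apply/blocksE; exists u.
exists (fun u => (f _ (B u)).+1) => // u v; split=> [uv|[/fi ->]]; last exact: same_block_refl.
have e : same_block c u = same_block c v.
  by apply: (@block_uniq _ c _ _ v) => //; exact: same_block_refl.
congr _.+1; move: (B u) (B v); rewrite e => Bu Bv.
by rewrite (Prop_irrelevance Bu Bv).
Qed.

Lemma bilateral_label c : infinite_set (bilateral_blocks c) ->
  exists2 l, exact_label c l & forall n, infinite_set [set x | l (inl x) = n] /\
    infinite_set [set y | l (inr y) = n].
Proof.
case/infinite_setE => W Wi WS.
have Wc n : blocks c (W n) by case: (WS n).
have Rfit u v n : same_block c u v -> W n u -> W n v.
  by move=> [A Ac [Au Av]] Wu; rewrite (block_uniq (Wc n) Ac Wu Au).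
have Runiq u n m : W n u -> W m u -> n = m.
  by move=> nu mu; apply: Wi; exact: block_uniq (Wc n) (Wc m) nu mu.
(* Block [W 0] shares the label 0 with all vertices outside the chosen blocks, which makes this
   fibre infinite too; exactness is claimed for nonzero labels only. *)
have [l lf [lE l0]] := @fits_of_relation _ c (fun u n => W n u) Rfit Runiq.
exists l; first split=> //.
  move=> u v uv u0; exists (W (l u)) => //; split; first exact: l0.
  by rewrite uv; apply: l0; rewrite -uv.
move=> n; have [_ iu il] := WS n.
by split; [apply: sub_infinite_set iu|apply: sub_infinite_set il] => x /lE.
Qed.

Section Factorization.
Variables (G : set (setPartition X)) (a b : setPartition X).
Hypotheses (GM : subsemigroup G) (GS : Sym X `<=` G) (Ga : G a) (Gb : G b).

Lemma unit_star c : Sym X c -> Sym X (pstar c).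
Proof.
move=> [d [cd dc]]; exists (pstar d).
rewrite -![pstar _ * _]pstarM.
by rewrite -[pmul d c]/(d * c) -[pmul c d]/(c * d) cd dc; split; exact: pstar1.
Qed.

Lemma generate_of_bilateral c d : monoidL X a -> monoidR X b ->
  infinite_set (codefect a) -> infinite_set (defect b) ->
  G c -> infinite_set (bilateral_blocks c) -> G d.
Proof.
move=> La Rb ia ib Gc /bilateral_label[l lc li].
have [g g0 gd] := partition_label d.
have [p pb e1] := absorb (fun x => g (inl x)) La ia lc (fun n => (li n).1).
have Lb : monoidL X (pstar b) by apply/monoidL_star.
have {}ib : infinite_set (codefect (pstar b)) by apply/infinite_delta_star.
(* The upper labels are those of [d] by now. Reversing the product lets the same lemma set the lower
   ones, with [pstar b] as the absorbing factor. *)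
have [q qb] := absorb (fun x => g (inr x)) Lb ib (exact_label_star e1) (fun n => (li n).2).
move/exact_label_star; rewrite !pstarM !pstarK => -[f e].
suff <- : a * (perm_partition p * c) * pstar (perm_partition q) * b = d.
  apply: (GM _ Gb); apply: GM; last exact/GS/unit_star/perm_partition_unit.
  by apply: (GM Ga); apply: GM => //; exact/GS/perm_partition_unit.
apply: setPartitionP => u v.
have gE w : g w = match flip w with inl x => g (inr x) | inr y =>
    match flip (inr y) with inl x => g (inl x) | inr z => l (inr z) end end.
  by case: w.
rewrite gd !gE; split; first exact: f.
by move=> h; apply: e => //; rewrite -gE.
Qed.

End Factorization.
End Absorption.

(** * Sufficiency, and generators in L *)

Section Generation.
Local Open Scope group_scope.
Variable X : Type.
Hypothesis cX : countable [set: X].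
Hypothesis iX : infinite_set [set: X].
Implicit Types (a b c : setPartition X) (G : set (setPartition X)).

(** Generation is stated as an induction principle, applied below to properties closed under
    products. *)
Definition generating a b := forall G, subsemigroup G -> Sym X `<=` G ->
  G a -> G b -> forall c, G c.

Lemma generatingP a b :
  [set: setPartition X] = generated (Sym X `|` [set a; b]) <-> generating a b.
Proof.
split=> [e G GM GS Ga Gb c|gen].
  have : [set: setPartition X] c by [].
  rewrite e; apply: smallest_sub => // d [/GS//|[->|->]] //.
apply/seteqP; split=> // c _; apply: gen.
- move=> x y gx gy H HS; case: (HS) => HM _.
  by apply: (HM); [exact: gx|exact: gy].
- by move=> x Sx; apply: sub_gen_smallest; left.
- by apply: sub_gen_smallest; right; left.
- by apply: sub_gen_smallest; right; right.
Qed.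

Lemma generating_sym a b : generating a b -> generating b a.
Proof. by move=> gen G GM GS Gb Ga; exact: gen. Qed.

Lemma generating_star a b : generating a b -> generating (pstar b) (pstar a).
Proof.
move=> gen G GM GS Gb Ga c; rewrite -[c]pstarK.
apply: (gen (@pstar X @^-1` G)) => //.
- move=> x y /= Gx Gy; rewrite -[x * y]/(pmul x y) pstarM; exact: GM.
- by move=> x /unit_star/GS.
Qed.

Lemma generating_of_condition a b : monoidL X a -> monoidR X b ->
  infinite_set (codefect a) -> infinite_set (defect b) ->
  infinite_set (kappa_star a `I_2) \/ infinite_set (delta_star a `I_2) ->
  infinite_set (kappa b `I_2) \/ infinite_set (delta b `I_3) ->
  generating a b.
Proof.
move=> La Rb ia ib ha hb G GM GS Ga Gb d.
have ta := monoidL_transversal iX La.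
have tb : infinite_set (transversal_blocks b).
  apply/infinite_transversal_star; apply: monoidL_transversal => //.
  exact/monoidL_star.
have GP p c1 c2 : bijective p -> G c1 -> G c2 -> G (c1 * (perm_partition p * c2)).
  move=> pb G1 G2; apply: (GM _ _ G1); apply: GM => //.
  exact/GS/perm_partition_unit.
have d32 c : infinite_set (delta c `I_3) -> infinite_set (delta c `I_2).
  apply: sub_infinite_set => A [Ac A3]; split=> //.
  by apply: card_le_trans A3; rewrite card_le_II.
(* If [b] does not qualify itself, its large upper blocks are used: as links between transversals of
   [a] with two lower vertices, by reversal of [widen_lower], or as branching points in
   [branch_upper]. *)
have [c Gc kc] : exists2 c, G c & infinite_set (kappa c `I_2).
  case: hb => [kb|db]; first by exists b.
  case: ha => [ka|da].
    have [|||p pb kp] := widen_lower cX (a := pstar b) (b := pstar a).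
    - exact/infinite_transversal_star.
    - exact/infinite_delta_star/d32.
    - by apply/infinite_kappa_star; rewrite pstarK.
    exists (a * pstar (perm_partition p) * b).
      apply: (GM _ _ _ Gb); apply: (GM _ _ Ga); apply: GS; apply: unit_star.
      exact: perm_partition_unit.
    by apply/infinite_kappa_star; rewrite -[_ * b]/(pmul _ _) pstarM pstarM pstarK.
  have [p pb kp] := branch_upper cX ta da tb db.
  by exists (a * (perm_partition p * b)) => //; exact: GP.
have [c' Gc' kc'] : exists2 c, G c & infinite_set (kappa_star c `I_2).
  case: ha => [ka|da]; first by exists a.
  have [p pb kp] := widen_lower cX ta da kc.
  by exists (a * (perm_partition p * c)) => //; exact: GP.
have [p pb bp] := zigzag cX kc' kc.
exact: (generate_of_bilateral cX GM GS Ga Gb _ La Rb ia ib (GP _ _ _ pb Gc' Gc) bp).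
Qed.

(** * Factors of elements of L *)

Lemma monoidL_mull a b : monoidL X (a * b) -> monoidL X a.
Proof.
move=> /monoidLP[E I]; apply/monoidLP; split=> [x|x y xy]; last first.
  by apply: I; apply/same_block_mul; exact: (joined_top _ xy).
apply: contrapT => nx; have [y /same_block_mul /= xy] := E x.
(* If the block of [x] in [a] has no lower vertex, it is already a whole component of the product
   graph. *)
pose Q p := match p with
  Upper z => same_block a (inl x) (inl z) | _ => False end.
suff: Q (Lower y) by [].
apply: (@joined_ind _ a b Q _ _ _ _ xy); last exact: same_block_refl.
- move=> [s|s] [t|t] //= st us; first exact: same_block_trans us st.
  by apply: nx; exists t; exact: same_block_trans us st.
- by move=> [].
Qed.

Lemma unit_perm a : Sym X a -> exists2 p, bijective p & a = perm_partition p.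
Proof.
move=> /SymE Sa.
have Sx x : exists y, same_block a (inl x) = [set inl x; inr y].
  have [|s [t e]] := Sa (same_block a (inl x)); first by apply/blocksE; exists (inl x).
  have : same_block a (inl x) (inl x) by exact: same_block_refl.
  by rewrite e => -[[->]|//]; exists t.
have Sy y : exists x, same_block a (inr y) = [set inl x; inr y].
  have [|s [t e]] := Sa (same_block a (inr y)); first by apply/blocksE; exists (inr y).
  have : same_block a (inr y) (inr y) by exact: same_block_refl.
  by rewrite e => -[//|[->]]; exists s.
have [p pE] := choice Sx; have [q qE] := choice Sy.
have xp x : same_block a (inl x) (inr (p x)) by rewrite pE; right.
have yq y : same_block a (inr y) (inl (q y)) by rewrite qE; left.
exists p.
  exists q => [x|y].
    by have := same_block_trans (xp x) (yq _); rewrite pE => -[[->]|].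
  by have := same_block_trans (yq y) (xp _); rewrite qE => -[|[->]].
have up u : same_block a u (inr (match u with inl x => p x | inr y => y end)).
  by case: u => x //=; exact: same_block_refl.
apply: setPartitionP => u v; rewrite same_block_kernel; split=> [uv|e].
  have := same_block_trans (same_block_sym (up u)) (same_block_trans uv (up v)).
  by rewrite qE => -[|[->]].
apply: same_block_trans (up u) _; rewrite e; exact: same_block_sym.
Qed.

Lemma monoidL_unitM a b : Sym X a -> monoidL X (a * b) -> monoidL X b.
Proof.
move=> /unit_perm[p pb ->] /monoidLP[E I]; apply/monoidLP.
have [q pK qK] := pb; split=> [x|x y xy].
  have [y /(same_block_permM _ _ _ pb)/=] := E (q x).
  by rewrite qK; exists y.
apply: (can_inj qK); apply: I; apply/(same_block_permM _ _ _ pb).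
by rewrite /= !qK.
Qed.

Lemma monoidLR_unit a : monoidL X a -> monoidR X a -> Sym X a.
Proof.
move=> /monoidLP[E I] /monoidL_star/monoidLP[E' I']; apply/SymE => A /blocksE[u ->].
have [x [y [ux uy]]] : exists x y, same_block a u (inl x) /\ same_block a u (inr y).
  case: u => z; first by have [y zy] := E z; exists z, y; split=> //; exact: same_block_refl.
  have [x /same_block_star zx] := E' z.
  by exists x, z; split=> //; exact: same_block_refl.
exists x, y; apply/seteqP; split=> [[z|z] uz|v [->|->] //]; [left|right].
  by congr inl; apply: I; exact: same_block_trans (same_block_sym uz) ux.
congr inr; apply: I'; apply/same_block_star.
exact: same_block_trans (same_block_sym uz) uy.
Qed.

Lemma proper_monoidL (f : X -> nat) (g : nat -> X) : cancel f g -> cancel g f ->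
  exists2 c, monoidL X c & ~ Sym X c.
Proof.
move=> fK gK.
(* The shift on the natural numbers, transported to [X]: the lower vertex [g 0] is left alone in its
   block. *)
exists (kernel (fun u => match u with inl x => g (f x).+1 | inr y => y end)).
  apply/monoidLP; split=> [x|x y /same_block_kernel/(can_inj gK)[]/(can_inj fK)//].
  by exists (g (f x).+1); apply/same_block_kernel.
move=> /SymE Sa; set a := kernel _ in Sa.
have [|x [y e]] := Sa (same_block a (inr (g 0))); first by apply/blocksE; eexists.
have : same_block a (inr (g 0)) (inl x) by rewrite e; left.
by move/same_block_kernel/(can_inj gK).
Qed.

(** The elements that are units whenever they lie in L form a subsemigroup containing all units. It
    is proper, so it misses a generator. *)
Lemma generating_monoidL a b : (exists2 c, monoidL X c & ~ Sym X c) ->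
  generating a b -> (monoidL X a /\ ~ Sym X a) \/ (monoidL X b /\ ~ Sym X b).
Proof.
move=> [c Lc nSc] gen; apply: contrapT => /not_orP[na nb]; apply: nSc.
apply: (gen [set d | monoidL X d -> Sym X d]) Lc => //=.
- move=> x y Hx Hy Lxy; have Sx := Hx (monoidL_mull Lxy).
  have [x' [xx x'x]] := Sx; have [y' [yy y'y]] := Hy (monoidL_unitM Sx Lxy).
  exists (y' * x'); split.
    by rewrite -mulgA (mulgA y) yy mul1g.
  by rewrite -mulgA (mulgA x') x'x mul1g.
- by move=> x Sx _.
- by move=> La; apply: contrapT => nS; apply: na.
- by move=> Lb; apply: contrapT => nS; apply: nb.
Qed.

End Generation.

(** * Subadditive block counts *)

Section Counting.
Local Open Scope group_scope.
Variable X : Type.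
Implicit Types (a b c : setPartition X) (u v w : X + X) (Bad : set (set (X + X))).

(* Distinct bad blocks of a product then come from disjoint components, each
   containing a bad block of a factor. *)
Definition subadditive Bad := forall a b u,
  (forall v, joined a b (top_emb v) (outer_emb u) -> ~ Bad (same_block a v)) ->
  (forall v, joined a b (bottom_emb v) (outer_emb u) -> ~ Bad (same_block b v)) ->
  ~ Bad (same_block (a * b) u).

(** Each bad block of the product is the trace [tr] on the outer vertices of the component of a bad
    block of a factor, so it lies in the image of a finite set. *)
Lemma finite_bad_mul Bad a b : subadditive Bad ->
  finite_set (blocks a `&` Bad) -> finite_set (blocks b `&` Bad) ->
  finite_set (blocks (a * b) `&` Bad).
Proof.
move=> sub fa fb.
pose tr (emb : X + X -> vertex3 X) (A : set (X + X)) :=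
  [set u | exists2 v, A v & joined a b (emb v) (outer_emb u)].
apply: (@sub_finite_set _ _ (tr (@top_emb X) @` (blocks a `&` Bad) `|`
                            tr (@bottom_emb X) @` (blocks b `&` Bad))); last first.
  by rewrite finite_setU; split; exact: finite_image.
move=> _ [/blocksE[u ->] Bu]; apply: contrapT => /not_orP[na nb].
apply: (sub _ _ _ _ _ Bu) => v jv Bv; [apply: na|apply: nb].
- exists (same_block a v); first by split=> //; apply/blocksE; exists v.
  apply/seteqP; split=> w.
    case=> v' /(joined_top b)/= vv' jw; apply/same_block_mul.
    by apply: rt_trans (joined_sym jv) _; apply: rt_trans vv' jw.
  by move=> /same_block_mul uw; exists v; [exact: same_block_refl|exact: rt_trans jv uw].
- exists (same_block b v); first by split=> //; apply/blocksE; exists v.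
  apply/seteqP; split=> w.
    case=> v' /(joined_bottom a)/= vv' jw; apply/same_block_mul.
    by apply: rt_trans (joined_sym jv) _; apply: rt_trans vv' jw.
  by move=> /same_block_mul uw; exists v; [exact: same_block_refl|exact: rt_trans jv uw].
Qed.

(** If no block met is bad, a lower vertex can climb through [b] to the middle row and from there
    through [a] to the top. *)
Lemma subadditive_lower : subadditive [set A | upper A = set0].
Proof.
move=> a b [x|y] Ha Hb e.
  have : set0 x by rewrite -e; exact: same_block_refl.
  by [].
have [z yz] : upper (same_block b (inr y)) !=set0.
  by apply/set0P/negP => /eqP; apply: Hb; exact: rt_refl.
have jz : joined a b (Lower y) (Middle z) by exact: (joined_bottom _ yz).
have [x zx] : upper (same_block a (inr z)) !=set0.
  by apply/set0P/negP => /eqP; apply: Ha; exact: joined_sym.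
have : set0 x.
  rewrite -e; apply/same_block_mul; apply: rt_trans jz _.
  exact: (joined_top _ zx).
by [].
Qed.

Lemma subadditive_lower2 : subadditive [set A | (`I_2 #<= lower A)%card].
Proof.
move=> a b u Ha Hb /card_le_I2[y1 [y2 [y12 /same_block_mul uy1 /same_block_mul uy2]]].
have {}Ha v : joined a b (top_emb v) (Lower y1) -> forall z z',
    same_block a v (inr z) -> same_block a v (inr z') -> z = z'.
  move=> jv z z' vz vz'; apply: contrapT => zz'.
  apply: (Ha v); first exact: rt_trans jv (joined_sym uy1).
  by apply/card_le_I2; exists z, z'.
have {}Hb z : same_block b (inr y1) (inr z) -> z = y1.
  move=> h; apply: contrapT => zy.
  apply: (Hb (inr y1)); first exact: joined_sym uy1.
  by apply/card_le_I2; exists z, y1; split=> //; exact: same_block_refl.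
(* The whole component of [y1]: its block in [b], together with the blocks of [a] that hang on it.
   Each of the latter has a single vertex in the middle row, so it leads to no further block of
   [b]. *)
pose Q p := match p with
  | Upper x => exists2 z, same_block b (inr y1) (inl z) & same_block a (inr z) (inl x)
  | Middle z => same_block b (inr y1) (inl z)
  | Lower y => y = y1 end.
have jM z : same_block b (inr y1) (inl z) -> joined a b (Middle z) (Lower y1).
  by move=> h; apply: joined_sym; exact: (joined_bottom _ h).
suff : Q (Lower y2) by move=> e; apply: y12.
apply: (@joined_ind _ a b Q (Lower y1)) => //.
- move=> s t st Qs.
  have [z yz zt] : exists2 z, same_block b (inr y1) (inl z) & same_block a (inr z) t.
    case: s st Qs => x /= st => [[z yz zx]|yx]; last by exists x.
    by exists z => //; exact: same_block_trans zx st.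
  case: t zt {st} => x zt /=; first by exists z.
  have -> // : x = z.
  exact: (Ha (inr z) (jM _ yz) _ _ zt (same_block_refl _ _)).
- move=> s t st Qs.
  have {Qs st} : same_block b (inr y1) t.
    by case: s st Qs => x st /=; [move/same_block_trans; apply|move=> e; rewrite -e].
  by case: t => z //= /Hb.
- exact: rt_trans (joined_sym uy1) uy2.
Qed.

(** * Components whose blocks have size at most 2 *)

Section Walk.
Variables (a b : setPartition X) (u : X + X).

(* An edge on side [false] (resp. [true]) comes from a block of [a] (resp. [b]). *)
Definition edge (side : bool) (z z' : vertex3 X) := exists s t, [/\ s <> t,
  same_block (if side then b else a) s t,
  z = (if side then bottom_emb s else top_emb s) &
  z' = (if side then bottom_emb t else top_emb t)].

Definition outer_side (v : X + X) := if v is inl _ then false else true.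

(* [walk n z side]: the walk leaving [u] and using the two sides alternately
   may be at [z] after [n] steps, with [side] the side of its next edge. *)
Inductive walk : nat -> vertex3 X -> bool -> Prop :=
| Walk0 : walk 0 (outer_emb u) (outer_side u)
| WalkS n z z' side : walk n z side -> edge side z z' -> walk n.+1 z' (~~ side).

Hypothesis edge_uniq : forall side z z' z'', joined a b (outer_emb u) z ->
  edge side z z' -> edge side z z'' -> z' = z''.

Lemma edge_sym side z z' : edge side z z' -> edge side z' z.
Proof.
case=> s [t [st sb -> ->]]; exists t, s; split=> //; first by move=> /esym.
exact: same_block_sym.
Qed.

Lemma edge_joined side z z' : edge side z z' -> joined a b z z'.
Proof.
by case: side => -[s [t [_ h -> ->]]]; [exact: joined_bottom|exact: joined_top].
Qed.

Lemma walk_joined n z side : walk n z side -> joined a b (outer_emb u) z.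
Proof.
elim=> [|{}n {}z z' {}side _ jz /edge_joined]; first exact: rt_refl.
exact: rt_trans.
Qed.

Lemma edge_outer side v z : edge side (outer_emb v) z -> side = outer_side v.
Proof. by case=> -[s|s] [t [_ _ + _]]; case: side v => [] []. Qed.

(** An edge on the expected side prolongs the walk; one on the other side retraces the last step. At
    the start there is no such edge, [u] being an outer vertex. *)
Lemma walk_edge n z side side' z' : walk n z side -> edge side' z z' ->
  exists m side'', walk m z' side''.
Proof.
move=> wz; have jz := walk_joined wz.
have [->|ns] := eqVneq side' side; first by move=> e; do 2 eexists; exact: WalkS wz e.
have {}ns : side' = ~~ side by case: side' side ns {wz} => [] [].
case: wz jz ns => [|m y {}z side0 wy e] jz -> e'.
  by move/edge_outer: e'; case: outer_side.
rewrite negbK in e'; exists m, side0.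
by rewrite -(edge_uniq jz (edge_sym e) e').
Qed.

Lemma joined_walk z : joined a b (outer_emb u) z -> exists n side, walk n z side.
Proof.
move=> j; apply: (@joined_ind _ a b (fun z => exists n side, walk n z side) _ _ _ _ j).
- move=> s t st [n [side w]]; have [->|nst] := pselect (t = s); first by exists n, side.
  by apply: (@walk_edge _ _ _ false _ w); exists s, t; split=> // e; apply: nst.
- move=> s t st [n [side w]]; have [->|nst] := pselect (t = s); first by exists n, side.
  by apply: (@walk_edge _ _ _ true _ w); exists s, t; split=> // e; apply: nst.
- by exists 0, (outer_side u); exact: Walk0.
Qed.

Lemma walk_uniq n z side z' side' : walk n z side -> walk n z' side' ->
  z = z' /\ side = side'.
Proof.
move=> w; elim: w z' side' => [|{}n {}z y {}side wz ih e] z' side' w'; inversion w' => //.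
subst; have [zz ss] := ih _ _ H0; subst; split=> //.
exact: edge_uniq (walk_joined wz) e H1.
Qed.

Lemma walk_prefix n k z side : walk (n.+1 + k) z side ->
  exists y y' side', walk n y side' /\ edge side' y y'.
Proof.
elim: k z side => [|k ih] z side.
  rewrite addn0 => w; inversion w; subst.
  by do 3 eexists; split; eassumption.
by rewrite addnS => w; inversion w; subst; exact: ih H0.
Qed.

(** An outer vertex has edges on one side only, and the walk has just arrived through that side. *)
Lemma walk_outer_stop n v side : walk n (outer_emb v) side -> u <> v ->
  forall z, ~ edge side (outer_emb v) z.
Proof.
move=> w uv z /edge_outer; move: w.
move E : (outer_emb v) => y w; case: w E => [|m y0 y1 side0 w e] E.
  by case: uv; case: (v) (u) E => x [] x' // [->].
by move: e; rewrite -E => /edge_sym/edge_outer->; case: outer_side.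
Qed.

Lemma walk_outer_uniq v v' : u <> v -> u <> v' ->
  joined a b (outer_emb u) (outer_emb v) -> joined a b (outer_emb u) (outer_emb v') ->
  v = v'.
Proof.
move=> uv uv' /joined_walk[n [s w]] /joined_walk[n' [s' w']].
have outer_inj (x y : X + X) : outer_emb x = outer_emb y -> x = y.
  by case: x y => x [] y // [->].
(* The longer walk is at [x] after [m] steps by determinism, yet it would have to leave it. *)
have no m m' x x' t t' : walk m (outer_emb x) t -> walk m' (outer_emb x') t' ->
    u <> x -> (m < m')%N -> False.
  move=> wx wx' ux mm'; move: wx'; rewrite -(subnKC mm') => /walk_prefix.
  move=> [y [y' [side [wy e]]]]; have [e1 e2] := walk_uniq wx wy; subst.
  exact: walk_outer_stop wx ux _ e.
have [lt|lt|e] := ltngtP n n'.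
- by case: (no _ _ _ _ _ _ w w' uv lt).
- by case: (no _ _ _ _ _ _ w' w uv' lt).
- by subst; apply: outer_inj; case: (walk_uniq w w').
Qed.

End Walk.

Lemma subadditive_size3 : subadditive [set A | (`I_3 #<= A)%card].
Proof.
move=> a b u0 Ha Hb /card_le_I3[u [v [w [[uv uw vw]]]]].
case=> /same_block_mul ju /same_block_mul jv /same_block_mul jw.
have {}jv := joined_outer_trans (joined_outer_sym ju) jv.
have {}jw := joined_outer_trans (joined_outer_sym ju) jw.
(* With walks starting at [u], the other two outer vertices must coincide. Two distinct edges from a
   vertex on one side would give a block with three vertices. *)
apply: vw; apply: (@walk_outer_uniq a b u) => // side z z' z'' jz.
have {jz} : joined a b z (outer_emb u0) by exact: joined_sym (rt_trans _ _ _ _ _ ju jz).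
have ti (x y : X + X) : top_emb x = top_emb y -> x = y by case: x y => x [] y // [->].
have bi (x y : X + X) : bottom_emb x = bottom_emb y -> x = y.
  by case: x y => x [] y // [->].
case: side => jz [s [t [st sb ez ->]]] [s' [t' [st' sb' ez' ->]]]; subst z.
  have ? := bi _ _ ez'; subst s'; apply: contrapT => tt'.
  apply: (Hb s) => //; apply/card_le_I3; exists s, t, t'; split; split=> //.
    by move=> e; apply: tt'; rewrite e.
  exact: same_block_refl.
have ? := ti _ _ ez'; subst s'; apply: contrapT => tt'.
apply: (Ha s) => //; apply/card_le_I3; exists s, t, t'; split; split=> //.
  by move=> e; apply: tt'; rewrite e.
exact: same_block_refl.
Qed.

End Counting.

(** * Necessity *)

Section Necessity.
Local Open Scope group_scope.
Variable X : Type.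
Implicit Types (a b c : setPartition X) (u v w : X + X) (Bad : set (set (X + X))).

(** Having finitely many bad blocks passes to products, and a unit has none. *)
Lemma finite_bad_generating Bad a b : generating a b -> subadditive Bad ->
  (forall x y, ~ Bad [set inl x; inr y]) ->
  finite_set (blocks a `&` Bad) -> finite_set (blocks b `&` Bad) ->
  forall c, finite_set (blocks c `&` Bad).
Proof.
move=> gen sub nB fa fb c.
apply: (gen [set c | finite_set (blocks c `&` Bad)]) => //.
  by move=> x y; exact: finite_bad_mul.
move=> d /SymE Sd /=; suff -> : blocks d `&` Bad = set0 by exact: finite_set0.
apply/seteqP; split=> // A [/Sd[x [y ->]]]; exact: nB.
Qed.

Lemma triples_partition (f : X -> nat) (g : nat -> X) : cancel f g -> cancel g f ->
  exists c, [/\ infinite_set (blocks c `&` [set A | upper A = set0]),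
    infinite_set (blocks c `&` [set A | (`I_2 #<= lower A)%card]) &
    infinite_set (blocks c `&` [set A | (`I_3 #<= A)%card])].
Proof.
move=> fK gK.
(* Both rows are cut into triples, and the boolean separates the rows; the lower triples are bad in
   all three senses. *)
pose l u := match u with inl x => (true, f x %/ 3) | inr x => (false, f x %/ 3) end.
have L n i : i < 3 -> l (inr (g (n * 3 + i))) = (false, n).
  by move=> i3; rewrite /= gK divnMDl // divn_small // addn0.
have S n i : i < 3 ->
    same_block (kernel l) (inr (g (n * 3 + 0))) (inr (g (n * 3 + i))).
  by move=> i3; apply/same_block_kernel; rewrite !L.
have D n i j : i != j -> g (n * 3 + i) <> g (n * 3 + j).
  by move=> /eqP ij /(can_inj gK)/addnI.
have F := @family_infinite _ (kernel l) _ (fun n => inr (g (n * 3 + 0))).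
exists (kernel l); split; apply: F => [i j /same_block_kernel|n].
all: try by rewrite !L // => -[].
all: split; first by apply/blocksE; eexists.
- by apply/seteqP; split=> // x /same_block_kernel.
- by apply/card_le_I2; exists (g (n * 3 + 0)), (g (n * 3 + 1)); split;
    [exact: D|exact: S..].
- apply/card_le_I3.
  exists (inr (g (n * 3 + 0))), (inr (g (n * 3 + 1))), (inr (g (n * 3 + 2))).
  by split; split; try exact: S; case; exact: D.
Qed.

Lemma monoidR_upper b A : monoidR X b -> blocks b A -> upper A !=set0.
Proof.
move=> [E _] Ab; have [[x|y] Au] := block_nonempty Ab; first by exists x.
by have [B Bb [By]] := E y; rewrite (block_uniq Bb Ab By Au).
Qed.

Lemma monoidR_lower2 b A : monoidR X b -> blocks b A -> ~ (`I_2 #<= lower A)%card.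
Proof. by move=> [_ I] Ab /card_le_I2[x [y [xy Ax Ay]]]; apply: xy; exact: I Ab Ax Ay. Qed.

Lemma lower2_blocks a :
  blocks a `&` [set A | (`I_2 #<= lower A)%card] `<=` kappa_star a `I_2 `|` delta_star a `I_2.
Proof.
move=> A [Aa A2]; have [e|/eqP/set0P uA] := pselect (upper A = set0).
  by right.
left; split=> //; split=> //; apply/card_le_I1; apply: card_le_trans A2.
by rewrite card_le_II.
Qed.

(** A block of an element of L has at most one upper vertex, so of three vertices at least two are
    lower, and all three if it is not transversal. *)
Lemma monoidL_size3 a : monoidL X a ->
  blocks a `&` [set A | (`I_3 #<= A)%card] `<=` kappa_star a `I_2 `|` delta_star a `I_3.
Proof.
move=> [_ I] A [Aa /= /card_le_I3[u [v [w [[uv uw vw] [Au Av Aw]]]]]].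
have [e|/eqP/set0P[x Ax]] := pselect (upper A = set0).
  right; split=> //; apply/card_le_I3.
  have inrE t : A t -> exists y, t = inr y.
    by case: t => [y|y] At; [have : set0 y by rewrite -e|exists y].
  have [[u' eu] [v' ev] [w' ew]] := And3 (inrE _ Au) (inrE _ Av) (inrE _ Aw); subst.
  by exists u', v', w'; split; split=> // e'; [apply: uv|apply: uw|apply: vw]; rewrite e'.
have ix y z : A (inl y) -> A (inl z) -> y = z by exact: I Aa.
have [y [z [yz Ay Az]]] : exists y z, [/\ y <> z, A (inr y) & A (inr z)].
  case: u v w uv uw vw Au Av Aw => u [] v [] w uv uw vw Au Av Aw.
  all: try by case: uv; rewrite (ix _ _ Au Av).
  all: try by case: uw; rewrite (ix _ _ Au Aw).
  all: try by case: vw; rewrite (ix _ _ Av Aw).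
  - by exists v, w; split=> // e; apply: vw; rewrite e.
  - by exists u, w; split=> // e; apply: uw; rewrite e.
  - by exists u, v; split=> // e; apply: uv; rewrite e.
  - by exists u, v; split=> // e; apply: uv; rewrite e.
left; split; last by apply/card_le_I2; exists y, z.
by split=> //; [exists x|exists y].
Qed.

(** By [triples_partition], one of the generators has infinitely many bad blocks of each kind. For
    the first two kinds this must be [a], since [b] in R has none. *)
Lemma generating_counts (f : X -> nat) (g : nat -> X) a b :
  cancel f g -> cancel g f -> generating a b -> monoidL X a -> monoidR X b ->
  [/\ infinite_set (codefect a),
    infinite_set (kappa_star a `I_2) \/ infinite_set (delta_star a `I_2) &
    (infinite_set (kappa_star a `I_2) \/ infinite_set (delta_star a `I_3)) \/
    (infinite_set (kappa b `I_2) \/ infinite_set (delta b `I_3))].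
Proof.
move=> fK gK gen La Rb; have [c [c1 c2 c3]] := triples_partition fK gK.
have empty Bad : (forall A, blocks b A -> ~ Bad A) -> finite_set (blocks b `&` Bad).
  move=> h; suff -> : blocks b `&` Bad = set0 by exact: finite_set0.
  by apply/seteqP; split=> // A [/h].
split.
- move=> fa; apply: c1; apply: (finite_bad_generating gen) => //.
  + exact: subadditive_lower.
  + by move=> x y e; have : set0 x by rewrite -e; left.
  + apply: sub_finite_set fa => A [Aa uA]; split=> //; apply/card_le_I1.
    have [[x|y] Au] := block_nonempty Aa; last by exists y.
    by have : set0 x by rewrite -uA.
  + apply: empty => A /(monoidR_upper Rb)[x Ax] e.
    by have : set0 x by rewrite -e.
- apply: contrapT => /not_orP[/contrapT fk /contrapT fd]; apply: c2.
  apply: (finite_bad_generating gen) => //.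
  + exact: subadditive_lower2.
  + move=> x y /card_le_I2[z [t [zt [//|[ez]] [//|[et]]]]].
    by apply: zt; rewrite ez et.
  + by apply: sub_finite_set (lower2_blocks (a := a)) _; rewrite finite_setU.
  + by apply: empty => A /(monoidR_lower2 Rb).
- apply: contrapT => /not_orP[/not_orP[/contrapT fk /contrapT fd]].
  move=> /not_orP[/contrapT fk' /contrapT fd']; apply: c3.
  apply: (finite_bad_generating gen) => //.
  + exact: subadditive_size3.
  + move=> x y /card_le_I3[z [t [w [[zt zw tw] [ez et ew]]]]].
    by move: zt zw tw; case: ez => ->; case: et => ->; case: ew => ->.
  + by apply: sub_finite_set (monoidL_size3 La) _; rewrite finite_setU.
  + apply: contrapT => ib; have Lb : monoidL X (pstar b) by exact/monoidL_star.
    have : infinite_set (kappa_star (pstar b) `I_2 `|` delta_star (pstar b) `I_3).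
      apply: sub_infinite_set (monoidL_size3 Lb) _; apply: infinite_flip ib => A [Ab A3].
      split; first exact/blocks_star.
      move: A3 => /card_le_I3[u [v [w [[uv uw vw] [Au Av Aw]]]]]; apply/card_le_I3.
      exists (flip u), (flip v), (flip w); split; split.
      1-3: by move/(can_inj (@flipK X)).
      1-3: by rewrite /preimage/mkset flipK.
    apply; rewrite finite_setU; split; apply: contrapT.
      by move/infinite_kappa_star.
    by move/infinite_delta_star.
Qed.

Lemma generating_condition_of (f : X -> nat) (g : nat -> X) a b :
  cancel f g -> cancel g f -> generating a b -> monoidL X a -> monoidR X b ->
  generating_condition a b.
Proof.
move=> fK gK gen La Rb.
have cX : countable [set: X].
  by apply: (@card_le_intro _ _ _ _ f) => // x y _ _ /(can_inj fK).
have cB c (S : set (set (X + X))) : S `<=` blocks c -> countable S.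
  by move=> Sc; apply: sub_countable (countable_blocks cX c); exact: subset_card_le.
have [ia a2 ab] := generating_counts fK gK gen La Rb.
have Lb : monoidL X (pstar b) by exact/monoidL_star.
have Ra : monoidR X (pstar a) by apply/monoidL_star; rewrite pstarK.
(* The reversed pair gives the counts for [b]. *)
have [ib b2 _] := generating_counts fK gK (generating_star gen) Lb Ra.
have {}ib : infinite_set (defect b) by move/infinite_delta_star: ib.
have {}b2 : infinite_set (kappa b `I_2) \/ infinite_set (delta b `I_2).
  by case: b2 => [/infinite_kappa_star|/infinite_delta_star]; [left|right].
split=> //.
- by apply: eq_card_nat ia; apply: (cB a) => A [[]].
- by apply: eq_card_nat ib; apply: (cB b) => A [[]].
(* The generator that supplies the blocks of size 3 decides between (ii) and (i). *)
case: ab => [a3|b3]; [right|left]; split; apply/disjoint_sum_aleph0 => //.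
all: by [apply: (cB a) => A [[]]|apply: (cB b) => A [[]]].
Qed.

Lemma generating_of_generating_condition a b :
  countable [set: X] -> infinite_set [set: X] ->
  generating_condition a b -> generating a b.
Proof.
move=> cX iX [La Rb ca db h].
have cB c (S : set (set (X + X))) : S `<=` blocks c -> countable S.
  by move=> Sc; apply: sub_countable (countable_blocks cX c); exact: subset_card_le.
have inf (S : set (set (X + X))) : (S #= [set: nat])%card -> infinite_set S.
  by move=> e; rewrite (eq_finite_set e); exact: infinite_nat.
have sums c (S S' : set (set (X + X))) : S `<=` blocks c -> S' `<=` blocks c ->
    (disjoint_sum S S' #= [set: nat])%card -> infinite_set S \/ infinite_set S'.
  by move=> /cB cS /cB cS'; move/(disjoint_sum_aleph0 cS cS').
have ka c I (mu : set I) : kappa_star c mu `<=` blocks c by move=> A [[]].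
have da c I (mu : set I) : delta_star c mu `<=` blocks c by move=> A [[]].
have kb c I (mu : set I) : kappa c mu `<=` blocks c by move=> A [[]].
have dd c I (mu : set I) : delta c mu `<=` blocks c by move=> A [[]].
case: h => -[/(sums a _ _ (ka _ _ _) (da _ _ _)) a2 /(sums b _ _ (kb _ _ _) (dd _ _ _)) b2].
  by apply: generating_of_condition => //; exact: inf.
(* Condition (ii) for [a] and [b] is (i) for [pstar b] and [pstar a]. *)
rewrite -[a]pstarK -[b]pstarK; apply: generating_star.
apply: generating_of_condition => //.
- exact/monoidL_star.
- by apply/monoidL_star; rewrite pstarK.
- by apply/infinite_delta_star; exact: inf.
- by apply/infinite_delta_star; rewrite pstarK; exact: inf.
- by case: b2 => ?; [left; apply/infinite_kappa_star|right; apply/infinite_delta_star].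
- case: a2 => ?; [left; apply/infinite_kappa_star|right; apply/infinite_delta_star];
    by rewrite pstarK.
Qed.

End Necessity.

Lemma card_nat_bijection T : ([set: T] #= [set: nat])%card ->
  exists (f : T -> nat) (g : nat -> T), cancel f g /\ cancel g f.
Proof.
case/card_bijP => f [g fK gK].
pose inT (x : T) : [set: T] := SigSub (mem_set (I : [set: T] x)).
pose inN (n : nat) : [set: nat] := SigSub (mem_set (I : [set: nat] n)).
exists (fun x => val (f (inT x))), (fun n => val (g (inN n))); split=> x.
  have -> : inN (val (f (inT x))) = f (inT x) by exact: val_inj.
  by rewrite fK.
have -> : inT (val (g (inN x))) = g (inN x) by exact: val_inj.
by rewrite gK.
Qed.

Theorem theorem22 (X : Type) (hX : ([set: X] #= [set: nat])%card)
    (alpha beta : setPartition X) :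
  [set: setPartition X] = generated (Sym X `|` [set alpha; beta]) <->
  generating_condition alpha beta \/ generating_condition beta alpha.
Proof.
have [f [g [fK gK]]] := card_nat_bijection hX.
rewrite generatingP; split=> [gen|].
  have nL := proper_monoidL fK gK.
  have nR c : ~ Sym X c -> ~ Sym X (pstar c).
    by move=> nS /unit_star; rewrite pstarK.
  have LR c : monoidL X c -> monoidL X (pstar c) -> Sym X c.
    by move=> Lc /monoidL_star; exact: monoidLR_unit.
  (* One generator is a nonunit of L and, by reversal, one is a nonunit of R. They differ, since an
     element of both L and R is a unit. *)
  have [[La nSa]|[Lb nSb]] := generating_monoidL nL gen;
  have [[Rb nSb']|[Ra nSa']] := generating_monoidL nL (generating_star gen).
  - by left; apply: generating_condition_of fK gK gen La _; exact/monoidL_star.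
  - by case: nSa; exact: LR.
  - by case: nSb; exact: LR.
  - right; apply: generating_condition_of fK gK (generating_sym gen) Lb _.
    exact/monoidL_star.
have cX : countable [set: X] by move: hX; rewrite card_eq_le => /andP[].
have iX : infinite_set [set: X] by rewrite (eq_finite_set hX); exact: infinite_nat.
case=> [|h]; first exact: generating_of_generating_condition.
by apply: generating_sym; exact: generating_of_generating_condition h.
Qed.
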